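(* Let $p$ be any prime and let $G=\mathbb{Z}_p\times H$, where $H$ is a finite discrete group and $G$ has the product topology. Then $G$ has a good filtration.
   Context: For a profinite group $P$ and a discrete $P$-module $M$, let $\lambda^s_M:H^s_c(P;M)\to H^s(P;M)$ be the natural map from continuous cohomology to abstract group cohomology (regarding continuous cochains as cochains). $P$ is called good if $\lambda^s_M$ is an isomorphism for all $s\ge0$ and every finite discrete $P$-module $M$. A profinite group $G$ has a good filtration if there is a directed poset $\Lambda$ and an inverse system $\mathcal{N}=\{N_\alpha\}_{\alpha\in\Lambda}$ of open normal subgroups of $G$ with inclusion maps ($\alpha_1\le\alpha_2$ iff $N_{\alpha_2}\subseteq N_{\alpha_1}$) such that (b) $\bigcap_\alpha N_\alpha=\{e\}$, (c) each $N_\alpha$ is good, and (d) there is a natural number $r_G$ with $H^s_c(N_\alpha;M)=0$ for all $s>r_G$, all $\alpha$, and all discrete $N_\alpha$-modules $M$. *)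

(* Defs.v *)
From mathcomp Require Import all_boot all_order all_algebra all_fingroup.
Set Implicit Arguments.
Unset Strict Implicit.
Unset Printing Implicit Defensive.
Import GRing.Theory Num.Theory.
Local Open Scope ring_scope.

(* Topological groups: a carrier with group operations and a predicate      *)
(* "is open" on subsets.  No axioms are bundled: the only groups used are   *)
(* the concrete group G = Z_p x H below and its subgroups (with the         *)
(* subspace topology), for which the axioms hold.                           *)
Record topgrp := TopGrp {
  gcarrier :> Type;
  gmul : gcarrier -> gcarrier -> gcarrier;
  gone : gcarrier;
  ginv : gcarrier -> gcarrier;
  gopen : (gcarrier -> Prop) -> Prop
}.

Record is_subgroup (G : topgrp) (N : G -> Prop) : Prop := IsSubgroup {
  sg_one : N (gone G);
  sg_mul : forall x y, N x -> N y -> N (gmul x y);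
  sg_inv : forall x, N x -> N (ginv x)
}.

Definition is_normal (G : topgrp) (N : G -> Prop) : Prop :=
  forall g x, N x -> N (gmul (gmul g x) (ginv g)).

Definition subgrp (G : topgrp) (N : G -> Prop) (HN : is_subgroup N) : topgrp :=
  {| gcarrier := {x : G | N x};
     gmul := fun x y => exist N (gmul (proj1_sig x) (proj1_sig y))
                          (sg_mul HN (proj2_sig x) (proj2_sig y));
     gone := exist N (gone G) (sg_one HN);
     ginv := fun x => exist N (ginv (proj1_sig x)) (sg_inv HN (proj2_sig x));
     gopen := fun V => exists U, @gopen G U /\
                forall x : {x : G | N x}, V x <-> U (proj1_sig x) |}.

Definition discrete_module (P : topgrp) (M : zmodType) (act : P -> M -> M)
  : Prop :=
  [/\ forall g x y, act g (x + y) = act g x + act g y,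
      forall x, act (gone P) x = x,
      forall g h x, act (gmul g h) x = act g (act h x) &
      (* M discrete and the action continuous: stabilizers are open *)
      forall x, @gopen P (fun g => act g x = x)].

Section Cochains.
Variables (P : topgrp) (M : zmodType) (act : P -> M -> M).

Definition sgn (n : nat) (x : M) : M := if odd n then - x else x.

Definition tdrop_last (s : nat) (t : s.+1.-tuple P) : s.-tuple P :=
  [tuple tnth t (widen_ord (leqnSn s) i) | i < s].

Definition tmerge (s : nat) (t : s.+1.-tuple P) (k : nat) : s.-tuple P :=
  [tuple (if (i < k)%N then tnth t (widen_ord (leqnSn s) i)
          else if (i == k :> nat) then
            gmul (tnth t (widen_ord (leqnSn s) i)) (tnth t (lift ord0 i))
          else tnth t (lift ord0 i)) | i < s].

Definition cobound (s : nat) (f : s.-tuple P -> M) : s.+1.-tuple P -> M :=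
  fun t => act (thead t) (f (behead_tuple t))
           + \sum_(k < s) sgn k.+1 (f (tmerge t k))
           + sgn s.+1 (f (tdrop_last t)).

(* continuity of a cochain P^s -> M, M discrete, P^s with product topology *)
Definition cont_cochain (s : nat) (f : s.-tuple P -> M) : Prop :=
  forall x : s.-tuple P, exists U : 'I_s -> (P -> Prop),
    (forall i, @gopen P (U i) /\ U i (tnth x i)) /\
    (forall y : s.-tuple P, (forall i, U i (tnth y i)) -> f y = f x).

Definition is_cocycle (s : nat) (f : s.-tuple P -> M) : Prop :=
  forall t, cobound f t = 0.

Definition is_coboundary_with (Q : forall s, (s.-tuple P -> M) -> Prop)
  (s : nat) : (s.-tuple P -> M) -> Prop :=
  match s return (s.-tuple P -> M) -> Prop with
  | 0 => fun f => forall t, f t = 0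
  | s'.+1 => fun f => exists h : s'.-tuple P -> M,
                Q s' h /\ forall t, f t = cobound h t
  end.

Definition is_coboundary := is_coboundary_with (fun _ _ => True).
Definition is_cont_coboundary := is_coboundary_with cont_cochain.

(* lambda^s_M : H^s_c(P;M) -> H^s(P;M) is a bijection (it is a group
   homomorphism, so this means it is an isomorphism):
   injectivity and surjectivity of the induced map Z_c/B_c -> Z/B. *)
Definition lambda_iso (s : nat) : Prop :=
  (forall f : s.-tuple P -> M, cont_cochain f -> is_cocycle f ->
     is_coboundary f -> is_cont_coboundary f) /\
  (forall f : s.-tuple P -> M, is_cocycle f ->
     exists f' : s.-tuple P -> M, [/\ cont_cochain f', is_cocycle f' &
       is_coboundary (fun t => f t - f' t)]).

Definition Hc_zero (s : nat) : Prop :=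
  forall f : s.-tuple P -> M, cont_cochain f -> is_cocycle f ->
    is_cont_coboundary f.

End Cochains.

Definition good (P : topgrp) : Prop :=
  forall (M : finZmodType) (act : P -> M -> M), discrete_module act ->
    forall s : nat, lambda_iso act s.

Definition directed_poset (L : Type) (le : L -> L -> Prop) : Prop :=
  [/\ inhabited L, forall a, le a a,
      forall a b c, le a b -> le b c -> le a c,
      forall a b, le a b -> le b a -> a = b &
      forall a b, exists c, le a c /\ le b c].

Definition has_good_filtration (G : topgrp) : Prop :=
  exists (L : Type) (le : L -> L -> Prop) (N : L -> G -> Prop)
         (HN : forall a, is_subgroup (N a)),
  [/\ directed_poset le,
      (forall a, is_normal (N a) /\ @gopen G (N a)),
      (forall a b, le a b <-> (forall x, N b x -> N a x)),
      (forall x, (forall a, N a x) -> x = gone G) &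
      (forall a, good (subgrp (HN a))) /\
      exists r : nat, forall a (M : zmodType) (act : subgrp (HN a) -> M -> M),
        discrete_module act -> forall s, (r < s)%N -> Hc_zero act s].

(* The p-adic integers Z_p as compatible sequences of residues:             *)
(* x = (x_n)_n with x_n in [0, p^n) and x_{n+1} mod p^n = x_n.               *)
Lemma modz_dvd_mod (e d m : int) : dvdz e d -> modz (modz m d) e = modz m e.
Proof.
move=> ed; apply/eqP; rewrite eqz_mod_dvd.
rewrite {2}(divz_eq m d) opprD addrA addrC addrA addNr add0r -mulNr.
exact: dvdz_mull.
Qed.

Definition ppow (p n : nat) : int := (p ^ n)%N%:Z.

Lemma ppow_dvd (p n : nat) : dvdz (ppow p n) (ppow p n.+1).
Proof. by rewrite /dvdz /ppow /= dvdn_exp2l. Qed.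

Definition Zp_compat (p : nat) (x : nat -> int) : Prop :=
  forall n, modz (x n.+1) (ppow p n) = x n.

Definition Zp (p : nat) : Type := {x : nat -> int | Zp_compat p x}.

Section ZpOps.
Variable p : nat.

Lemma Zp_add_compat (x y : Zp p) :
  Zp_compat p (fun n => modz (proj1_sig x n + proj1_sig y n) (ppow p n)).
Proof.
move=> n; rewrite modz_dvd_mod ?ppow_dvd //.
rewrite -(proj2_sig x n) -(proj2_sig y n).
by apply/eqP; rewrite modzDm.
Qed.

Lemma Zp_opp_compat (x : Zp p) :
  Zp_compat p (fun n => modz (- proj1_sig x n) (ppow p n)).
Proof.
move=> n; rewrite modz_dvd_mod ?ppow_dvd //.
rewrite -(proj2_sig x n).
by apply/eqP; rewrite modzNm.
Qed.

Lemma Zp_zero_compat : Zp_compat p (fun _ => 0).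
Proof. by move=> n; rewrite mod0z. Qed.

Definition Zp_add (x y : Zp p) : Zp p := exist _ _ (Zp_add_compat x y).
Definition Zp_opp (x : Zp p) : Zp p := exist _ _ (Zp_opp_compat x).
Definition Zp_zero : Zp p := exist _ _ Zp_zero_compat.
End ZpOps.

(* G = Z_p x H, H a finite discrete group, with the product topology:
   U is open iff it contains, around each of its points (x, h), a basic
   neighbourhood (x + p^n Z_p) x {h}. *)
Definition ZpxH (p : nat) (H : finGroupType) : topgrp :=
  {| gcarrier := (Zp p * H)%type;
     gmul := fun a b => (Zp_add a.1 b.1, (a.2 * b.2)%g);
     gone := (Zp_zero p, 1%g);
     ginv := fun a => (Zp_opp a.1, (a.2)^-1%g);
     gopen := fun U => forall a, U a -> exists n : nat,
                forall y : Zp p, proj1_sig y n = proj1_sig a.1 n -> U (y, a.2) |}.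

(* Main.v *)
Require Import Defs.
From mathcomp Require Import all_boot all_order all_algebra all_fingroup.
From HB Require Import structures.
From mathcomp Require Import boolp functions classical_sets filter cyclic ring.

(* Each N_n = p^n Z_p x 1 is a copy of A = Z_p, so everything reduces to the
   cohomology of A, computed with homogeneous cochains A^(k+1) -> M.  Without
   equivariance these form a contractible complex, and the generator 1 of A
   turns equivariance into one condition: a cochain that is fixed by 1 and by
   some p^k A is fixed by A.  Given an equivariant cocycle F, write F = d h with
   h fixed by some p^k A; then (1 - id) h is a cocycle, hence d E, and one can
   solve (1 - id) E' = E - w, w a cocycle, as soon as the norms of E and w over
   a finite cyclic quotient agree.  Then h - d E' is an equivariant primitive of
   F.  The correction w exists in degree >= 2 for finite M, and in degree >= 3
   for every M, which gives the uniform bound r = 2.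

   For continuous cochains a primitive fixed by some p^k A comes from the
   contraction.  For abstract cochains with finite M it is built on finitely
   generated subgroups and passed to the limit by compactness of M: finitely
   generated subgroups of A are free, and when m kills M, restriction from d to
   m d makes the obstruction to equivariance under d a coboundary, because
   translations act trivially on cohomology. *)

Set Implicit Arguments.
Unset Strict Implicit.
Unset Printing Implicit Defensive.
Import GRing.Theory Num.Theory.
Local Open Scope ring_scope.
Local Notation padic := Defs.Zp.

(** * Linear identities in abelian groups *)

Inductive zexpr :=
  | ZVar of nat | Zero | ZAdd of zexpr & zexpr | ZOpp of zexpr
  | ZMulz of zexpr & int.

Fixpoint zeval (A : zmodType) (env : seq A) (e : zexpr) : A :=
  match e with
  | ZVar i => env`_i
  | Zero => 0
  | ZAdd e1 e2 => zeval env e1 + zeval env e2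
  | ZOpp e1 => - zeval env e1
  | ZMulz e1 k => zeval env e1 *~ k
  end.

Fixpoint zcoef (e : zexpr) (i : nat) : int :=
  match e with
  | ZVar j => if j == i then 1 else 0
  | Zero => 0
  | ZAdd e1 e2 => zcoef e1 i + zcoef e2 i
  | ZOpp e1 => - zcoef e1 i
  | ZMulz e1 k => zcoef e1 i * k
  end.

(** A recursive conjunction rather than a quantifier over indices: after [cbn] it splits into one
    [ring] goal per atom. *)
Fixpoint zcoefs_eq (n : nat) (e1 e2 : zexpr) : Prop :=
  if n is n'.+1 then zcoef e1 n' = zcoef e2 n' /\ zcoefs_eq n' e1 e2 else True.

Lemma zevalE (A : zmodType) (env : seq A) e :
  zeval env e = \sum_(i < size env) env`_i *~ zcoef e i.
Proof.
elim: e => [j||e1 IH1 e2 IH2|e IH|e IH k] /=.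
- have [lt_j|le_j] := ltnP j (size env).
    rewrite (bigD1 (Ordinal lt_j)) //= eqxx mulr1z big1 ?addr0 // => i.
    by rewrite -val_eqE /= eq_sym => /negPf ->; rewrite mulr0z.
  rewrite nth_default // big1 // => i _.
  by rewrite gtn_eqF ?mulr0z // (leq_trans (ltn_ord i)).
- by rewrite big1 // => i _; rewrite mulr0z.
- by rewrite IH1 IH2 -big_split; apply: eq_bigr => i _; rewrite /= mulrzDr.
- by rewrite IH -sumrN; apply: eq_bigr => i _; rewrite mulrNz.
by rewrite IH mulrz_suml; apply: eq_bigr => i _; rewrite mulrzA.
Qed.

Lemma zmod_reflect (A : zmodType) (env : seq A) e1 e2 :
  zcoefs_eq (size env) e1 e2 -> zeval env e1 = zeval env e2.
Proof.
move=> h; rewrite !zevalE; apply: eq_bigr => -[i /= lt_i] _; congr (_ *~ _).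
elim: (size env) h lt_i => // n IH [hn /IH{}IH].
by rewrite ltnS leq_eqVlt => /predU1P[->|/IH].
Qed.

(* Atoms are compared up to unification, since the same sum may be elaborated
   through different paths of the algebraic hierarchy. *)
Ltac zsame x y := match goal with _ => unify x y end.

Ltac zindex x env :=
  match env with
  | ?y :: _ => let _ := zsame x y in constr:(0%N)
  | _ :: ?env' => let n := zindex x env' in constr:(n.+1)
  end.

Ltac zmember x env :=
  match env with
  | [::] => constr:(false)
  | ?y :: _ => let _ := zsame x y in constr:(true)
  | _ :: ?env' => zmember x env'
  end.

Ltac zatoms e env :=
  lazymatch e with
  | (?a + ?b)%R => let env1 := zatoms a env in zatoms b env1
  | (- ?a)%R => zatoms a env
  | (?a *~ _)%R => zatoms a env
  | (?a *+ _)%R => zatoms a env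
  | 0%R => env
  | _ => lazymatch zmember e env with
         | true => env
         | false => constr:(e :: env)
         end
  end.

Ltac zreify e env :=
  lazymatch e with
  | (?a + ?b)%R =>
      let ea := zreify a env in let eb := zreify b env in constr:(ZAdd ea eb)
  | (- ?a)%R => let ea := zreify a env in constr:(ZOpp ea)
  | (?a *~ ?k)%R => let ea := zreify a env in constr:(ZMulz ea k)
  | (?a *+ ?n)%R => let ea := zreify a env in constr:(ZMulz ea (Posz n))
  | 0%R => constr:(Zero)
  | _ => let i := zindex e env in constr:(ZVar i)
  end.

(* Decides linear identities in abelian groups, with integer coefficients
   compared by [ring]. *)
Ltac zmod :=
  lazymatch goal with
  | |- @eq ?A ?l ?r =>
      let env := zatoms l (@nil A) in
      let env := zatoms r env in
      let el := zreify l env in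
      let er := zreify r env in
      refine (@zmod_reflect _ env el er _);
      cbn [zcoefs_eq zcoef size];
      cbn -[GRing.mul GRing.add GRing.opp GRing.one GRing.zero];
      repeat split; try ring
  end.

(** * Homogeneous cochains *)

Lemma fctB (T : Type) (M : zmodType) (F G : T -> M) s : (F - G) s = F s - G s.
Proof. by []. Qed.

Lemma fctD (T : Type) (M : zmodType) (F G : T -> M) s : (F + G) s = F s + G s.
Proof. by []. Qed.

Section Homogeneous.
Variables (A M : zmodType).
Implicit Types (F G : seq A -> M) (s t : seq A) (a b d x : A).

Definition slice x F : seq A -> M := fun t => F (x :: t).

(* [dlt F [:: x_0; ..; x_k]] is the alternating sum of the values of [F] at the
   lists with one [x_i] omitted. *)
Fixpoint dlt_rec s F : M :=
  if s is x :: t then F t - dlt_rec t (slice x F) else 0.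
Definition dlt F : seq A -> M := fun s => dlt_rec s F.

Lemma dlt_cons F x t : dlt F (x :: t) = F t - dlt (slice x F) t.
Proof. by []. Qed.

Lemma slice_dlt F x : slice x (dlt F) = F - dlt (slice x F).
Proof. by apply: funext => t. Qed.

Lemma slice_is_additive x : zmod_morphism (slice x).
Proof. by []. Qed.
HB.instance Definition _ x :=
  GRing.isZmodMorphism.Build (seq A -> M) (seq A -> M) (slice x)
    (slice_is_additive x).

Lemma dlt_is_additive : zmod_morphism dlt.
Proof.
move=> F G; apply: funext => s; rewrite fctB.
elim: s F G => [|x t IH] F G; first by rewrite /dlt /= subrr.
by rewrite !dlt_cons raddfB IH fctB !opprD addrACA.
Qed.
HB.instance Definition _ :=
  GRing.isZmodMorphism.Build (seq A -> M) (seq A -> M) dlt dlt_is_additive.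

Lemma dltB F G : dlt (F - G) = dlt F - dlt G.
Proof. exact: raddfB. Qed.

Lemma dlt0 : dlt 0 = 0.
Proof. exact: raddf0. Qed.

Lemma dlt_dlt F : dlt (dlt F) = 0.
Proof.
apply: funext => s; elim: s F => [|x t IH] F //.
by rewrite dlt_cons slice_dlt dltB fctB IH subr0 subrr.
Qed.

(* A cochain of degree [n - 1] is a function supported on lists of size [n]. *)
Definition supp n F := forall s, size s != n -> F s = 0.

Lemma supp_dlt n F : supp n F -> supp n.+1 (dlt F).
Proof.
move=> + s; elim: s n F => [|x t IH] n F sF // sz.
rewrite dlt_cons sF // sub0r; case: n sF sz => [|n] sF sz.
  have -> : slice x F = 0 by apply: funext => u; apply: sF.
  by rewrite dlt0 oppr0.
by rewrite (IH n) ?oppr0 // => u su; apply: sF.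
Qed.

Lemma supp_slice n F x : supp n.+1 F -> supp n (slice x F).
Proof. by move=> sF t st; apply: sF. Qed.

Lemma supp0 n : supp n 0.
Proof. by []. Qed.

Lemma suppD n F G : supp n F -> supp n G -> supp n (F + G).
Proof. by move=> sF sG s ss; rewrite fctD sF ?sG ?addr0. Qed.

Lemma suppN n F : supp n F -> supp n (- F).
Proof. by move=> sF s ss; rewrite -[LHS]/(- F s) sF ?oppr0. Qed.

Lemma suppB n F G : supp n F -> supp n G -> supp n (F - G).
Proof. by move=> sF sG; apply: suppD => //; apply: suppN. Qed.

Lemma supp_sum n (I : Type) (r : seq I) (P : pred I) (E : I -> seq A -> M) :
  (forall i, supp n (E i)) -> supp n (\sum_(i <- r | P i) E i).
Proof.
by move=> sE; elim/big_rec: _ => [|i F _ sF]; [exact: supp0|exact: suppD].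
Qed.

Lemma suppMn n F k : supp n F -> supp n (F *+ k).
Proof.
move=> sF; elim: k => [|k IH]; first exact: supp0.
by rewrite mulrS; apply: suppD.
Qed.

(* Inserting [a] in front contracts the complex without equivariance. *)
Lemma dlt_slice a F : dlt F = 0 -> dlt (slice a F) = F.
Proof.
by move=> dF; have := slice_dlt F a; rewrite dF => /eqP;
  rewrite eq_sym subr_eq0 => /eqP.
Qed.

Definition shift d s := [seq x - d | x <- s].

Lemma shift0 s : shift 0 s = s.
Proof. by rewrite /shift -[RHS]map_id; apply: eq_map => x; rewrite subr0. Qed.

Lemma shiftD d e s : shift (d + e) s = shift e (shift d s).
Proof.
by rewrite /shift -map_comp; apply: eq_map => x /=; rewrite opprD addrA.
Qed.

Lemma dlt_shift d F : dlt (fun s => F (shift d s)) = fun s => dlt F (shift d s).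
Proof.
apply: funext => s; elim: s F => [|x t IH] F //.
by rewrite -[RHS]/(dlt F (x - d :: shift d t)) !dlt_cons -(IH (slice (x - d) F)).
Qed.

(* The prism [(x_0,..,x_i,x_i - d,..,x_k - d)] summed with signs: the cochain
   homotopy between the identity and translation by [d]. *)
Fixpoint prism_rec d s F : M :=
  if s is x :: t then F (x :: x - d :: shift d t) - prism_rec d t (slice x F)
  else 0.
Definition prism d F : seq A -> M := fun s => prism_rec d s F.

Lemma prism_cons d F x t :
  prism d F (x :: t) = F (x :: x - d :: shift d t) - prism d (slice x F) t.
Proof. by []. Qed.

Lemma slice_prism d F x :
  slice x (prism d F) =
  (fun t => slice (x - d) (slice x F) (shift d t)) - prism d (slice x F).
Proof. by []. Qed.

Lemma prism_is_additive d : zmod_morphism (prism d).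
Proof.
move=> F G; apply: funext => s; rewrite fctB.
elim: s F G => [|x t IH] F G; first by rewrite /prism /= subrr.
by rewrite !prism_cons raddfB IH fctB !opprD addrACA.
Qed.
HB.instance Definition _ d :=
  GRing.isZmodMorphism.Build (seq A -> M) (seq A -> M) (prism d)
    (prism_is_additive d).

Lemma prismB d F G : prism d (F - G) = prism d F - prism d G.
Proof. exact: raddfB. Qed.

(** By induction on the list, [slice_dlt] and [slice_prism] express both terms through the slice at
    the head, where the induction hypothesis applies; the terms left over cancel in pairs. *)
Lemma prism_dlt d F :
  prism d (dlt F) + dlt (prism d F) = (fun s => F (shift d s)) - F.
Proof.
apply: funext => s; rewrite fctD fctB.
elim: s F => [|x t IH] F; first by rewrite /prism /dlt /= addr0 subrr.
have := IH (slice x F); rewrite !prism_cons !dlt_cons slice_dlt slice_prism.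
rewrite !prismB !dltB !fctB !dlt_shift /=.
move: (prism d (dlt _) t) (dlt (prism d (slice x F)) t) => p q.
rewrite /slice.
move: (dlt _ (shift d t)) (F (x :: shift d t)) (prism d F t) => D S u e.
rewrite -addrA (opprB u) (addrA (p - u)) subrK !opprB -!addrA; congr (_ + _).
rewrite [RHS](_ : _ = p + q - S); last by rewrite e addrAC subrr add0r.
by rewrite addrCA (addrC q) (addrCA p) addNKr addrC.
Qed.

Lemma supp_prism n d F : supp n.+1 F -> supp n (prism d F).
Proof.
move=> sF s sz.
(* Only lists one entry longer than [s] matter; in this form the hypothesis passes to slices, with
   no [n] to follow. *)
have {sF sz} : forall u, size u = (size s).+1 -> F u = 0.
  by move=> u su; apply: sF; rewrite su eqSS.
elim: s F => [|x t IH] F F0 //.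
rewrite prism_cons F0 /= ?size_map // sub0r IH ?oppr0 // => u su.
by apply: F0; rewrite /= su.
Qed.

End Homogeneous.

(** * Equivariance *)

Section Action.
Variables (A M : zmodType) (al : A -> M -> M).
Hypothesis al_add : forall a x y, al a (x + y) = al a x + al a y.
Hypothesis al_0 : forall x, al 0 x = x.
Hypothesis al_act : forall a b x, al (a + b) x = al a (al b x).
Implicit Types (F G : seq A -> M) (s t : seq A) (a b d x : A).

Lemma al_zmod a : zmod_morphism (al a).
Proof.
have z : al a 0 = 0 by apply: (addrI (al a 0)); rewrite -al_add !addr0.
move=> x y; apply: (addIr (al a y)); rewrite -addrA addNr addr0.
by rewrite -al_add subrK.
Qed.
HB.instance Definition _ a := GRing.isZmodMorphism.Build M M (al a) (al_zmod a).

(** The action of [A] on homogeneous cochains; its fixed points are the equivariant cochains. *)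
Definition twist a F : seq A -> M := fun s => al a (F (shift a s)).

Lemma tw_is_additive a : zmod_morphism (twist a).
Proof. by move=> F G; apply: funext => s; rewrite /twist !fctB (raddfB (al a)). Qed.
HB.instance Definition _ a :=
  GRing.isZmodMorphism.Build (seq A -> M) (seq A -> M) (twist a) (tw_is_additive a).

Lemma twB a F G : twist a (F - G) = twist a F - twist a G.
Proof. exact: raddfB. Qed.

Lemma twN a F : twist a (- F) = - twist a F.
Proof. exact: raddfN. Qed.

Lemma tw_sum a (I : Type) (r : seq I) (P : pred I) (E : I -> seq A -> M) :
  twist a (\sum_(i <- r | P i) E i) = \sum_(i <- r | P i) twist a (E i).
Proof. exact: raddf_sum. Qed.

Lemma tw0 F : twist 0 F = F.
Proof. by apply: funext => s; rewrite /twist al_0 shift0. Qed.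

Lemma twD a b F : twist (a + b) F = twist a (twist b F).
Proof. by apply: funext => s; rewrite /twist al_act shiftD. Qed.

Lemma twC a b F : twist a (twist b F) = twist b (twist a F).
Proof. by rewrite -!twD addrC. Qed.

Lemma supp_tw n a F : supp n F -> supp n (twist a F).
Proof. by move=> sF s ss; rewrite /twist sF ?size_map // (raddf0 (al a)). Qed.

Lemma dlt_comp (g : {additive M -> M}) F :
  dlt (fun s => g (F s)) = fun s => g (dlt F s).
Proof.
apply: funext => s; elim: s F => [|x t IH] F; first by rewrite /dlt /= raddf0.
by rewrite !dlt_cons raddfB -IH.
Qed.

Lemma prism_comp d (g : {additive M -> M}) F :
  prism d (fun s => g (F s)) = fun s => g (prism d F s).
Proof.
apply: funext => s; elim: s F => [|x t IH] F; first by rewrite /prism /= raddf0.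
by rewrite !prism_cons raddfB -IH.
Qed.

Lemma prism_shift d b F :
  prism d (fun s => F (shift b s)) = fun s => prism d F (shift b s).
Proof.
apply: funext => s; elim: s F => [|x t IH] F; first by [].
rewrite -[RHS]/(prism d F (x - b :: shift b t)) !prism_cons.
rewrite -(IH (slice (x - b) F)); congr (F _ - _).
by rewrite -[LHS]/([:: x - b, x - d - b & shift b (shift d t)])
  -!shiftD (addrC b) addrAC.
Qed.

Lemma dlt_tw a F : dlt (twist a F) = twist a (dlt F).
Proof. by rewrite /twist (dlt_comp (al a)) dlt_shift. Qed.

Lemma prism_tw d a F : prism d (twist a F) = twist a (prism d F).
Proof. by rewrite /twist (prism_comp d (al a)) prism_shift. Qed.

(* Integration along the free orbits of [g]: the height function [N] numbers
   the points of each [g]-orbit consistently along cosets of [B]. *)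
Lemma tw_sub_surj g (B : A -> Prop) (N : A -> int) n e :
  (forall x, N (x + g) = N x + 1) ->
  (forall x b, B b -> N (x + b) = N x) ->
  supp n e -> e [::] = 0 -> (forall b, B b -> twist b e = e) ->
  exists e', [/\ supp n e', forall b, B b -> twist b e' = e' & twist g e' - e' = e].
Proof.
move=> Ng NB se e0 eB.
(* Partial sums in both directions from [E 0 = 0], solving the recursion stated in [Estep]. *)
pose E (k : int) := match k with
  | Posz i => - \sum_(j < i) twist (g *+ j) e
  | Negz i => \sum_(j < i.+1) twist (- (g *+ j.+1)) e end.
have Estep k : twist g (E (k - 1)) - E k = e.
  case: k => [[|i]|i].
  - rewrite /E /= big_ord_recl !big_ord0 oppr0 subr0 addr0 mulr1n -twD subrr.
    by rewrite tw0.
  - rewrite (_ : i.+1%:Z - 1 = i%:Z); last by rewrite -addn1 PoszD addrK.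
    rewrite /E big_ord_recl /= mulr0n tw0 twN tw_sum opprK addrC -addrA.
    rewrite (eq_bigr (fun j : 'I_i => twist g (twist (g *+ j) e))) ?subrr ?addr0 //.
    by move=> j _; rewrite -twD mulrS.
  - rewrite (_ : Negz i - 1 = Negz i.+1); last by rewrite !NegzE -opprD -PoszD addn1.
    rewrite /E [X in twist g X]big_ord_recl /= raddfD /= tw_sum.
    rewrite (_ : twist g (twist _ e) = e); last by rewrite -twD subrr tw0.
    rewrite [X in e + X](_ : _ = \sum_(j < i.+1) twist (- (g *+ j.+1)) e) ?addrK //.
    by apply: eq_bigr => j _; rewrite -twD (mulrS g j.+1) opprD addNKr.
have EB b k : B b -> twist b (E k) = E k.
  move=> Bb; case: k => i; rewrite /E ?twN tw_sum; [congr (- _)|];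
  by apply: eq_bigr => j _; rewrite twC eB.
have sE k : supp n (E k).
  by case: k => i; rewrite /E; first apply: suppN;
    apply: supp_sum => j; apply: supp_tw.
(* The height of the first entry selects the partial sum; translating by [g] lowers it by one, which
   turns [Estep] into the required equation. *)
pose e' s := if s is x :: _ then E (N x) s else 0.
exists e'; split.
- by move=> [//|x t] st; rewrite /e' sE.
- move=> b Bb; apply: funext => -[|x t]; first exact: (raddf0 (al b)).
  rewrite -[RHS]/(E (N x) (x :: t)) -(EB b) //.
  have <- : N (x - b) = N x by rewrite -(NB (x - b) b) ?subrK.
  by [].
apply: funext => -[|x t].
  by rewrite fctB e0 [twist _ _ _](raddf0 (al g)) subrr.
rewrite fctB -[e in RHS](Estep (N x)) fctB -[X in N X](subrK g) Ng addrK.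
by rewrite -Ng subrK.
Qed.

(** The class of [F] dies on restriction to [B]. *)
Definition bounds_over (B : A -> Prop) n F :=
  exists h, [/\ supp n h, forall b, B b -> twist b h = h & dlt h = F].

Definition adjoin (g : A) (B : A -> Prop) : A -> Prop :=
  fun x => exists k : int, B (x - g *~ k).

Definition subgroup (B : A -> Prop) :=
  B 0 /\ forall x y, B x -> B y -> B (x - y).

Lemma subgroupN B x : subgroup B -> B x -> B (- x).
Proof. by move=> [B0 Bsub] /(Bsub _ _ B0); rewrite sub0r. Qed.

Lemma subgroupD B x y : subgroup B -> B x -> B y -> B (x + y).
Proof.
by move=> sB Bx /(subgroupN sB)/((proj2 sB) _ _ Bx); rewrite opprK.
Qed.

Lemma subgroupMn B x n : subgroup B -> B x -> B (x *+ n).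
Proof.
move=> sB Bx; elim: n => [|n IH]; first exact: (proj1 sB).
by rewrite mulrS; apply: subgroupD.
Qed.

Lemma subgroupMz B x (k : int) : subgroup B -> B x -> B (x *~ k).
Proof.
by move=> sB Bx; case: k => n; [|apply: subgroupN => //]; apply: subgroupMn.
Qed.

Lemma subgroup_adjoin g B : subgroup B -> subgroup (adjoin g B).
Proof.
move=> [B0 Bsub]; split; first by exists 0; rewrite mulr0z subrr.
move=> x y [k Bk] [l Bl]; exists (k - l).
by rewrite (_ : _ - _ = x - g *~ k - (y - g *~ l)); [exact: Bsub|zmod].
Qed.

(** Choose a point in each coset of [adjoin g B]. The coefficient of [g] in the displacement from
    that point is well defined, since no nonzero multiple of [g] lies in [B]. *)
Lemma height_function g B : subgroup B ->
  (forall k : int, B (g *~ k) -> k = 0) ->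
  exists N : A -> int, (forall x, N (x + g) = N x + 1) /\
    (forall x b, B b -> N (x + b) = N x).
Proof.
move=> sB indep.
pose coset x : set A := fun y => adjoin g B (y - x).
have coset_eq x y : adjoin g B (y - x) -> coset x = coset y.
  move=> h; apply: funext => z; apply: propext; rewrite /coset; split=> h'.
    rewrite (_ : z - y = z - x - (y - x)); last by zmod.
    exact: (proj2 (subgroup_adjoin g sB)).
  rewrite (_ : z - x = z - y + (y - x)); last by zmod.
  by apply: subgroupD => //; apply: subgroup_adjoin.
pose rep x := xget 0 (coset x).
have repP x : adjoin g B (x - rep x).
  rewrite -opprB; apply: subgroupN; first exact: subgroup_adjoin.
  apply: (@xgetPex _ 0 (coset x)); exists x.
  by rewrite /coset subrr; apply: (proj1 (subgroup_adjoin g sB)).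
have [N NP] := choice repP.
have Nuniq x (k : int) : B (x - rep x - g *~ k) -> N x = k.
  move=> Bk; apply/eqP; rewrite -subr_eq0; apply/eqP/indep.
  rewrite (_ : _ *~ _ = (x - rep x - g *~ k) - (x - rep x - g *~ N x)).
    exact: (proj2 sB).
  zmod.
have rep_eq x b : adjoin g B b -> rep (x + b) = rep x.
  by move=> Bb; rewrite /rep (coset_eq x (x + b)) ?[x + b - x]addrC ?addKr.
exists N; split=> [x|x b Bb]; apply: Nuniq; rewrite rep_eq.
- by rewrite (_ : _ - _ = x - rep x - g *~ N x) //; zmod.
- by exists 1; rewrite mulr1z subrr; exact: (proj1 sB).
- rewrite (_ : _ - _ = x - rep x - g *~ N x + b); last by zmod.
  exact: subgroupD.
by exists 0; rewrite mulr0z subr0.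
Qed.

Lemma tw_iter_sub d m F :
  twist (d *+ m) F - F = \sum_(i < m) twist (d *+ i) (twist d F - F).
Proof.
elim: m => [|m IH]; first by rewrite big_ord0 mulr0n tw0 subrr.
by rewrite big_ord_recr -IH /= twB mulrSr twD; zmod.
Qed.

Lemma subgroup_stab F : subgroup (fun b => twist b F = F).
Proof.
split; first exact: tw0.
by move=> x y Fx Fy; rewrite -{1}Fy -twD subrK.
Qed.

(** The cocycle [y] measures the failure of a primitive [h] over [B] to be fixed by [d]. As [d] acts
    trivially on [M], the prism makes the translates of [y] cohomologous to [y], so for [d *+ m] the
    failure is [y *+ m], which is zero, plus the coboundary of an explicit [e]. Independence of
    [d *+ m] from [B] lets [tw_sub_surj] absorb [e]. *)
Lemma bounds_over_adjoin (m : nat) d B n F :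
  (forall v : M, v *+ m = 0) -> (forall v, al d v = v) ->
  subgroup B -> (forall k : int, B ((d *+ m) *~ k) -> k = 0) ->
  twist d F = F -> bounds_over B n.+1 F -> bounds_over (adjoin (d *+ m) B) n.+1 F.
Proof.
move=> m0 ald sB indep dF [h [sh hB dh]].
pose y := twist d h - h.
have dy : dlt y = 0 by rewrite /y dltB dlt_tw dh dF subrr.
have twE G : twist d G = (fun s => G (shift d s)).
  by apply: funext => s; rewrite /twist ald.
pose Q := prism d y.
have yQ i : twist (d *+ i) y = y + dlt (\sum_(j < i) twist (d *+ j) Q).
  have := tw_iter_sub d i y; rewrite [twist d y]twE -prism_dlt dy.
  rewrite (raddf0 (prism d)) add0r => /(canRL (subrK _)) ->.
  by rewrite addrC raddf_sum; congr (_ + _); apply: eq_bigr => j _ /=;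
    rewrite dlt_tw.
pose e := \sum_(i < m) \sum_(j < i) twist (d *+ j) Q.
have de : twist (d *+ m) h - h = dlt e.
  rewrite tw_iter_sub (eq_bigr _ (fun (i : 'I_m) _ => yQ i)) big_split /=.
  rewrite sumr_const card_ord raddf_sum /= (_ : y *+ m = 0) ?add0r //.
  by apply: funext => s; rewrite natmulfctE m0.
have [N [Ng NB]] := height_function sB indep.
have sQ : supp n Q by apply: supp_prism; apply: suppB => //; apply: supp_tw.
have se : supp n e.
  by do 2! [apply: supp_sum => ?]; apply: supp_tw.
have e0 : e [::] = 0.
  rewrite /e fct_sumE big1 // => i _; rewrite fct_sumE big1 // => j _.
  exact: (raddf0 (al _)).
have yB b : B b -> twist b y = y by move=> Bb; rewrite twB twC hB.
have eB b : B b -> twist b e = e.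
  move=> Bb; rewrite tw_sum; apply: eq_bigr => i _; rewrite tw_sum.
  by apply: eq_bigr => j _; rewrite twC -prism_tw yB.
have [e' [se' e'B he']] := tw_sub_surj Ng NB se e0 eB.
exists (h - dlt e'); split.
- by apply: suppB => //; apply: supp_dlt.
- move=> x [k Bk]; rewrite -(subrK ((d *+ m) *~ k) x).
  have sS := subgroup_stab (h - dlt e').
  apply: (subgroupD sS); first by rewrite twB -dlt_tw hB ?e'B.
  apply: (subgroupMz k sS); apply: subr0_eq.
  rewrite twB -dlt_tw
    (_ : _ - _ = twist (d *+ m) h - h - (dlt (twist (d *+ m) e') - dlt e')).
    by rewrite de -dltB he' subrr.
  zmod.
by rewrite dltB dlt_dlt subr0.
Qed.

End Action.

(** * Finite coefficients *)

(** [H] is the pointwise limit of [h] along an ultrafilter that contains, for each [L], the set of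
    lists including [L]. Finitely many limit values are then attained together at some [l] including
    [L]. *)
Lemma finite_compactness (I X : eqType) (M : finType) (h : seq I -> X -> M) :
  exists H : X -> M, forall (S : seq X) (L : seq I),
    exists2 l, {subset L <= l} & forall s, s \in S -> H s = h l s.
Proof.
pose cone (L : seq I) : set (seq I) := [set l : seq I | {subset L <= l}]%classic.
have conesP : ProperFilter (filter_from [set: seq I]%classic cone).
  apply: filter_from_proper; last by move=> L _; exists L => x.
  apply: filter_from_filter; first by exists [::].
  move=> L1 L2 _ _; exists (L1 ++ L2) => // l sub.
  by split=> x xL; apply: sub; rewrite mem_cat xL ?orbT.
have [G [Gultra Gcones]] := ultraFilterLemma conesP.
have limit x : exists v, G [set l | h l x = v]%classic.
  apply: contrapT => nolim.
  (* If no value were taken on a member of [G], the finitely many complements would meet in a member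
     of [G] that is empty. *)
  have : G [set l | h l x \notin enum M]%classic.
    elim: (enum M) => [|v r IH]; first exact: filterS filterT.
    have [Gv|Gv] := in_ultra_setVsetC [set l | h l x = v]%classic Gultra.
      by case: nolim; exists v.
    apply: filterS (filterI Gv IH) => l [/= /eqP nv nr].
    by rewrite inE negb_or nv.
  by move=> /filter_ex [l]; rewrite /= mem_enum.
have [H HP] := choice limit.
exists H => S L.
have : G [set l | forall s, s \in S -> H s = h l s]%classic.
  elim: S => [|x S IH]; first exact: filterS filterT.
  apply: filterS (filterI (HP x) IH) => l [/= hx hS] s.
  by rewrite inE => /predU1P[->|/hS].
have GL : G (cone L) by apply: Gcones; exists L.
by move=> /(filterI GL)/filter_ex [l [lL lS]]; exists l.
Qed.

(** * Independent generators in torsion-free abelian groups *)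

Section Basis.
Variable A : zmodType.
Implicit Types (L l : seq A) (x g e : A) (k : int).

Fixpoint span L : A -> Prop :=
  if L is g :: L' then adjoin g (span L') else fun x => x = 0.

Fixpoint indep L : Prop :=
  if L is g :: L' then (forall k, span L' (g *~ k) -> k = 0) /\ indep L'
  else True.

Lemma subgroup_span L : subgroup (span L).
Proof.
elim: L => [|g L IH] /=; last exact: subgroup_adjoin.
by split=> // x y /= -> ->; rewrite subrr.
Qed.

Lemma adjoin_sub g (B : A -> Prop) x : B x -> adjoin g B x.
Proof. by exists 0; rewrite mulr0z subr0. Qed.

Hypothesis torsion_free : forall x k, x *~ k = 0 -> k != 0 -> x = 0.

(** One step of integral elimination. A relation between [g] and the head [e], with coefficients of
    gcd [D], yields a unimodular change from [e], [g] to [e'], [z] such that [z *~ D] lies in the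
    span of the tail, where induction adjoins [z]. The factor [K] carries the new span back into the
    old one, which is how [e'] inherits independence from [e]. *)
Lemma indep_saturate l0 g k :
  indep l0 -> k != 0 -> span l0 (g *~ k) ->
  exists l1 (K : int), [/\ indep l1, K != 0, span l1 g,
    forall x, span l0 x -> span l1 x & forall x, span l1 x -> span l0 (x *~ K)].
Proof.
elim: l0 g k => [|e l0 IH] g n /=.
  by move=> _ n0 /torsion_free/(_ n0) ->; exists [::], 1; split=> // x ->.
move=> [e_ind ind0] n0 [c s0P].
have [u [v uvE]] := Bezoutz n c.
set D := gcdz n c in uvE.
have D0 : D != 0 by rewrite gcdz_eq0 negb_and n0.
have /dvdzP[n1 n1E] : (D %| n)%Z := dvdz_gcdl n c.
have /dvdzP[c1 c1E] : (D %| c)%Z := dvdz_gcdr n c.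
have uv1 : u * n1 + v * c1 = 1.
  by apply: (mulIf D0); rewrite mul1r -[RHS]uvE [in RHS]n1E [in RHS]c1E; ring.
have sub0 := subgroup_span l0.
pose z := e *~ c1 - g *~ n1.
have zP : span l0 (z *~ D).
  rewrite (_ : _ *~ _ = - (g *~ n - e *~ c)); first exact: subgroupN.
  by rewrite /z n1E c1E; zmod.
have [l1 [K [ind1 K0 z1 sub01 sub10]]] := IH z D ind0 D0 zP.
have sub1 := subgroup_span l1.
pose e' := e *~ u + g *~ v.
have e'n : e' *~ n = e *~ D + (g *~ n - e *~ c) *~ v.
  by rewrite /e' -uvE; zmod.
have e_in : adjoin e' (span l1) e.
  exists n1; rewrite (_ : _ - _ = z *~ v); first exact: subgroupMz.
  by rewrite -[X in X - _]mulr1z -uv1 /z /e'; zmod.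
exists (e' :: l1), (K * n); split=> /=.
- split=> // k /sub10 h; have := subgroupMz n sub0 h.
  have -> : e' *~ k *~ K *~ n = e *~ (D * k * K) + (g *~ n - e *~ c) *~ (v * k * K).
    rewrite (_ : _ *~ n = e' *~ n *~ (k * K)); last by zmod.
    by rewrite e'n; zmod.
  move=> /(fun h => subgroupD sub0 h (subgroupMz (- (v * k * K)) sub0 s0P)).
  rewrite [X in span _ X](_ : _ = e *~ (D * k * K)); last by zmod.
  by move=> /e_ind /eqP; rewrite !mulf_eq0 (negPf D0) (negPf K0) orbF /= => /eqP.
- by rewrite mulf_neq0.
- exists c1; rewrite (_ : _ - _ = z *~ (- u)); first exact: subgroupMz.
  by rewrite -[X in X - _]mulr1z -uv1 /z /e'; zmod.
- move=> x [k /sub01 xk]; rewrite -(subrK (e *~ k) x).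
  have sub2 := subgroup_adjoin e' sub1.
  by apply: (subgroupD sub2); [apply: adjoin_sub|apply: subgroupMz].
move=> x [k /sub10 xk]; exists (k * K * D).
have -> : x *~ (K * n) - e *~ (k * K * D) =
    (x - e' *~ k) *~ K *~ n + (g *~ n - e *~ c) *~ (v * k * K).
  rewrite (_ : (_ - _) *~ K *~ n = x *~ (K * n) - e' *~ n *~ (k * K)).
    by rewrite e'n; zmod.
  by zmod.
by apply: (subgroupD sub0); apply: subgroupMz.
Qed.

(** Elements are added one at a time: one with no nonzero multiple in the current span joins the
    list, any other is absorbed by [indep_saturate]. *)
Lemma basis l : exists l', indep l' /\ forall x, x \in l -> span l' x.
Proof.
elim: l => [|g l [l' [ind sub]]]; first by exists [::].
have [[k k0 kg]|free] := pselect (exists2 k, k != 0 & span l' (g *~ k)).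
  have [l1 [K [ind1 _ g1 sub1 _]]] := indep_saturate ind k0 kg.
  by exists l1; split=> // x /predU1P[->|/sub/sub1].
exists (g :: l'); split=> [|x] /=.
  split=> // k kg; apply/eqP; apply: contra_notT free => k0; by exists k.
move=> /predU1P[->|/sub/adjoin_sub]; last exact.
by exists 1; rewrite mulr1z subrr; apply: (proj1 (subgroup_span l')).
Qed.

Lemma span_mulrn m l x :
  span [seq g *+ m | g <- l] x <-> exists2 y, span l y & x = y *+ m.
Proof.
elim: l x => [|g l IH] x /=.
  by split=> [->|[y -> ->]]; rewrite ?mul0rn //; exists 0; rewrite ?mul0rn.
split=> [[k /IH[y yl e]]|[y [k yk] ->]].
  exists (y + g *~ k); first by exists k; rewrite addrK.
  by rewrite mulrnDl -e; zmod.
by exists k; apply/IH; exists (y - g *~ k) => //; zmod.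
Qed.

Lemma indep_mulrn m l : (0 < m)%N -> indep l -> indep [seq g *+ m | g <- l].
Proof.
move=> m0; elim: l => [|g l IH] //= [gl /IH indl]; split=> // k.
move=> /span_mulrn [y yl e]; apply: gl.
suff -> : g *~ k = y by [].
apply: subr0_eq; apply: (@torsion_free _ m); last by rewrite eqz_nat -lt0n.
rewrite [LHS](_ : _ = g *+ m *~ k - y *+ m); last by zmod.
by rewrite e subrr.
Qed.

End Basis.

(** * Primitives over finitely generated subgroups and their limit *)

Section FiniteCoefficients.
Variables (A : zmodType) (M : finZmodType) (al : A -> M -> M).
Hypothesis al_add : forall a x y, al a (x + y) = al a x + al a y.
Hypothesis al_0 : forall x, al 0 x = x.
Hypothesis al_act : forall a b x, al (a + b) x = al a (al b x).
Hypothesis torsion_free : forall (x : A) (k : int), x *~ k = 0 -> k != 0 -> x = 0.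

(** This is what lets the equation [dlt h = F] pass to the limit of [finite_compactness]. *)
Lemma dlt_local (s : seq A) : exists S : seq (seq A), forall F G : seq A -> M,
  (forall t, t \in S -> F t = G t) -> dlt F s = dlt G s.
Proof.
elim: s => [|x t [S SP]]; first by exists [::].
exists (t :: [seq x :: u | u <- S]) => F G eqS.
rewrite !dlt_cons eqS ?mem_head // (SP _ (slice x G)) // => u uS.
by apply: eqS; rewrite inE; apply/orP; right; apply: map_f.
Qed.

(** For finitely many elements, take an independent list [L] spanning them. Contraction gives a
    primitive over the trivial subgroup, and the elements [g *+ q *+ m] are adjoined one by one;
    each [g *+ q] acts trivially on [M] and fixes [F], as [bounds_over_adjoin] requires. Every
    condition on the limit [H] involves finitely many values and at most one group element. *)
Lemma equivariant_primitive (q m n : nat) (F : seq A -> M) :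
  (0 < q)%N -> (0 < m)%N -> (forall v : M, v *+ m = 0) ->
  (forall a v, al (a *+ q) v = v) -> (forall a, twist al (a *+ q) F = F) ->
  supp n.+2 F -> dlt F = 0 ->
  exists h, [/\ supp n.+1 h, forall a, twist al (a *+ (q * m)) h = h & dlt h = F].
Proof.
move=> q0 m0 Mm alq Fq sF dF.
have finite (l : seq A) : exists h, [/\ supp n.+1 h,
    forall a, a \in l -> twist al (a *+ (q * m)) h = h & dlt h = F].
  have [L [indL subL]] := basis torsion_free l.
  have ind : indep [seq g *+ m | g <- [seq g *+ q | g <- L]].
    by apply: indep_mulrn => //; apply: indep_mulrn.
  suff [h [sh hL dh]] :
      bounds_over al (span [seq g *+ m | g <- [seq g *+ q | g <- L]]) n.+1 F.
    exists h; split=> // a /subL aL; apply: hL; apply/span_mulrn.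
    by exists (a *+ q); [apply/span_mulrn; exists a|rewrite mulrnA].
  elim: {indL subL} L ind => [_|g L IH [gfree /IH bL]].
    exists (slice 0 F); split; first exact: supp_slice.
      by move=> b ->; apply: tw0.
    exact: dlt_slice.
  apply: bounds_over_adjoin bL => //; first exact: subgroup_span.
have [h hP] := choice finite.
have [H HP] := finite_compactness h.
exists H; split.
- move=> s ss; have [l _ ->] := HP [:: s] [::]; last by rewrite mem_head.
  by have [sh _ _] := hP l; apply: sh.
- move=> a; apply: funext => s.
  have [l la lS] := HP [:: s; shift (a *+ (q * m)) s] [:: a].
  have [_ /(_ a)ha _] := hP l.
  rewrite /twist !lS ?inE ?eqxx ?orbT //.
  by apply: (congr1 (fun f => f s) (ha _)); apply: la; rewrite mem_head.
apply: funext => s; have [S SP] := dlt_local s.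
have [l _ lS] := HP S [::].
by have [_ _ dh] := hP l; rewrite (SP _ _ lS) dh.
Qed.

End FiniteCoefficients.

(** * Procyclic groups *)

Section Procyclic.
Variables (A : zmodType) (p : nat) (sg : A) (rs : nat -> A -> nat).
(** In the application [sg] is the topological generator 1 and [rs k] is reduction modulo [p ^ k],
    so multiples of [sg] represent the quotient by [pow_sub k]. *)
Definition pow_sub k : A -> Prop := fun x => exists y, x = y *+ (p ^ k)%N.
Hypothesis p_gt1 : (1 < p)%N.
Hypothesis rs_lt : forall k x, (rs k x < p ^ k)%N.
Hypothesis rs_eq : forall k x y, rs k x = rs k y <-> pow_sub k (x - y).
Hypothesis rs_sg : forall k i, rs k (sg *+ i) = (i %% p ^ k)%N.

Lemma subgroup_pow_sub k : subgroup (pow_sub k).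
Proof.
split; first by exists 0; rewrite mul0rn.
by move=> x y [u ->] [v ->]; exists (u - v); rewrite mulrnBl.
Qed.

Lemma pow_sub_le j k x : (j <= k)%N -> pow_sub k x -> pow_sub j x.
Proof.
move=> jk [y ->]; exists (y *+ p ^ (k - j)).
by rewrite -mulrnA -expnD subnK.
Qed.

Lemma rs_small k i : (i < p ^ k)%N -> rs k (sg *+ i) = i.
Proof. by move=> ik; rewrite rs_sg modn_small. Qed.

Lemma rs_repr k x : pow_sub k (x - sg *+ rs k x).
Proof. by apply/rs_eq; rewrite rs_small. Qed.

Lemma rs_sub_eq0 k x i : (i < p ^ k)%N ->
  (rs k (x - sg *+ i) == 0)%N = (i == rs k x).
Proof.
move=> ik; have z : rs k 0 = 0%N by rewrite -(mulr0n sg) rs_small ?expn_gt0 ?(ltnW p_gt1).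
apply/eqP/eqP.
  by rewrite -{1}z => /rs_eq; rewrite subr0 => /rs_eq ->; rewrite rs_small.
by move=> ->; rewrite -[RHS]z; apply/rs_eq; rewrite subr0; exact: rs_repr.
Qed.

(** The residue wraps around at 0; that case is where [tw_sg_surj] uses the vanishing of the full
    norm. *)
Lemma rs_sub_sg k x :
  rs k (x - sg) = if rs k x is r.+1 then r else (p ^ k).-1.
Proof.
have pk : (0 < p ^ k)%N by rewrite expn_gt0 (ltnW p_gt1).
have := rs_repr k x; have := rs_lt k x; case: (rs k x) => [|r] rk xr.
  rewrite -[RHS](@rs_small k) ?prednK //; apply/rs_eq.
  rewrite [X in pow_sub _ X](_ : _ = x - sg *+ 0 - sg *+ p ^ k).
    by apply: (proj2 (subgroup_pow_sub k) _ _ xr); exists sg.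
  by rewrite -[in RHS](prednK pk) mulrS; zmod.
rewrite -[RHS](@rs_small k) ?(ltnW rk) //; apply/rs_eq.
by rewrite [X in pow_sub _ X](_ : _ = x - sg *+ r.+1) // mulrS; zmod.
Qed.

Variables (M : zmodType) (al : A -> M -> M).
Hypothesis al_add : forall a x y, al a (x + y) = al a x + al a y.
Hypothesis al_0 : forall x, al 0 x = x.
Hypothesis al_act : forall a b x, al (a + b) x = al a (al b x).
Implicit Types (F E : seq A -> M).
Local Notation tw := (twist al).

(** When [sg *+ Q] fixes [F], this is the norm for the cyclic group of order [Q]. *)
Definition nrm Q F := \sum_(i < Q) tw (sg *+ i) F.

Lemma nrmB Q F E : nrm Q (F - E) = nrm Q F - nrm Q E.
Proof. by rewrite -sumrB; apply: eq_bigr => i _; rewrite twB. Qed.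

Lemma dlt_nrm Q F : dlt (nrm Q F) = nrm Q (dlt F).
Proof. by rewrite raddf_sum; apply: eq_bigr => i _; rewrite /= dlt_tw. Qed.

Lemma supp_nrm n Q F : supp n F -> supp n (nrm Q F).
Proof. by move=> sF; apply: supp_sum => i; apply: supp_tw. Qed.

Lemma nrmD Q R F : nrm (Q + R) F = nrm Q F + tw (sg *+ Q) (nrm R F).
Proof.
rewrite /nrm big_split_ord tw_sum //=; congr (_ + _); apply: eq_bigr => i _.
by rewrite -twD // -mulrnDr.
Qed.

Lemma nrmS Q F : nrm Q.+1 F = F + tw sg (nrm Q F).
Proof. by rewrite -add1n nrmD {1}/nrm big_ord_recl big_ord0 addr0 tw0. Qed.

Lemma tw_nrm Q F : tw sg (nrm Q F) - nrm Q F = tw (sg *+ Q) F - F.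
Proof.
rewrite tw_iter_sub // -/(nrm Q (tw sg F - F)) nrmB; congr (_ - _).
by rewrite tw_sum //; apply: eq_bigr => i _; apply: twC.
Qed.

Lemma nrm_fixed Q F : tw sg F = F -> nrm Q F = F *+ Q.
Proof.
move=> Fsg; rewrite -[in RHS](card_ord Q) -sumr_const; apply: eq_bigr => i _.
exact: (subgroupMn i (subgroup_stab al_0 al_act F)).
Qed.

Lemma nrm_periodic Q t F : tw (sg *+ Q) F = F -> nrm (Q * t) F = nrm Q F *+ t.
Proof.
move=> FQ; elim: t => [|t IH]; first by rewrite muln0 /nrm big_ord0.
rewrite mulnS nrmD IH mulrS; congr (_ + _); rewrite raddfMn /=; congr (_ *+ _).
by rewrite tw_sum //; apply: eq_bigr => i _; rewrite twC // FQ.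
Qed.

(* [X] stands for all cochains fixed by some [p ^ k A], or for those that are
   moreover locally constant. *)
Section Class.
Variable X : (seq A -> M) -> Prop.
Hypothesis X_sub : forall F E, X F -> X E -> X (F - E).
Hypothesis X_dlt : forall F, X F -> X (dlt F).
Hypothesis X_tw : forall F, X F -> X (tw sg F).
Hypothesis X_if : forall k (P : pred nat) F, X F ->
  X (fun s => if P (rs k (head 0 s)) then F s else 0).
Hypothesis X_fixed : forall F, X F ->
  exists k, forall x, pow_sub k x -> tw x F = F.
Hypothesis X_exact : forall n F, X F -> supp n.+2 F -> dlt F = 0 ->
  exists h, [/\ X h, supp n.+1 h & dlt h = F].

Lemma X_add F E : X F -> X E -> X (F + E).
Proof.
move=> XF XE; have X0 : X 0 by rewrite -(subrr F); apply: X_sub.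
by rewrite -[E]opprK -(sub0r E); apply: X_sub => //; apply: X_sub.
Qed.

Lemma X_sum F Q (E : nat -> seq A -> M) : X F ->
  (forall i, X (E i)) -> X (\sum_(i < Q) E i).
Proof.
move=> XF XE; have X0 : X 0 by rewrite -(subrr F); apply: X_sub.
by elim/big_ind: _ => // F1 F2; apply: X_add.
Qed.

Lemma X_twMn F i : X F -> X (tw (sg *+ i) F).
Proof.
by move=> XF; elim: i => [|i IH]; rewrite ?mulr0n ?tw0 // mulrS twD //; apply: X_tw.
Qed.

Lemma X_nrm Q F : X F -> X (nrm Q F).
Proof. by move=> XF; exact: (X_sum Q XF (fun i => X_twMn i XF)). Qed.

Lemma X_mulrn Q F : X F -> X (F *+ Q).
Proof.
by move=> XF; rewrite -[Q]card_ord -sumr_const; exact: (X_sum Q XF (fun=> XF)).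
Qed.

Lemma X_fixed_sg F : X F -> tw sg F = F -> forall a, tw a F = F.
Proof.
move=> XF Fsg a; have [k Fk] := X_fixed XF.
have sF := subgroup_stab al_0 al_act F.
rewrite -(subrK (sg *+ rs k a) a).
by apply: (subgroupD sF); [exact/Fk/rs_repr|exact: (subgroupMn _ sF)].
Qed.

(* Hilbert 90 for the cyclic quotient of order [p ^ k]: [E'] is the partial norm
   of [E] up to the residue of the first argument. *)
Lemma tw_sg_surj k n E : X E -> supp n.+1 E -> nrm (p ^ k) E = 0 ->
  exists E', [/\ X E', supp n.+1 E' & tw sg E' - E' = E].
Proof.
move=> XE sE NE.
(* The range of the partial norm depends on the point; masking each term by a condition on the
   residue keeps the sum in [X], by [X_if]. *)
pose part i : seq A -> M :=
  fun s => if (i < rs k (head 0%R s))%N then tw (sg *+ i) E s else 0.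
have sp i : supp n.+1 (part i).
  by move=> s ss; rewrite /part (supp_tw al_add _ sE) ?if_same.
exists (- \sum_(i < p ^ k) part i); split.
- rewrite -sub0r; apply: X_sub; first by rewrite -(subrr E); apply: X_sub.
  by apply: (X_sum _ XE) => i; apply: (X_if k (fun r => i < r)%N); apply: X_twMn.
- by apply: suppN; apply: supp_sum.
have partE x t : (\sum_(i < p ^ k) part i) (x :: t) = nrm (rs k x) E (x :: t).
  rewrite /nrm !fct_sumE.
  rewrite (big_ord_widen _ (fun i => tw (sg *+ i) E (x :: t)) (ltnW (rs_lt k x))).
  by rewrite [RHS]big_mkcond.
apply: funext => -[|x t].
  rewrite [RHS]sE //.
  have s0 : supp n.+1 (- \sum_(i < p ^ k) part i).
    by apply: suppN; apply: supp_sum.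
  by apply: (suppB (supp_tw al_add sg s0) s0).
rewrite fctB -[X in _ - X]/(- _) partE opprK.
have -> : tw sg (- \sum_(i < p ^ k) part i) (x :: t) =
    - tw sg (nrm (rs k (x - sg)) E) (x :: t).
  by rewrite -[RHS]/((- tw sg _) (x :: t)) -twN // /twist /= -[X in al _ X]/(- _) partE.
have -> : tw sg (nrm (rs k (x - sg)) E) = nrm (rs k (x - sg)).+1 E - E.
  by rewrite nrmS addrAC subrr add0r.
rewrite fctB rs_sub_sg; case: (rs k x) (rs_lt k x) => [|r] rk.
  rewrite prednK ?expn_gt0 ?(ltnW p_gt1) // NE /nrm big_ord0.
  by rewrite -[LHS]/(- (0 - E (x :: t)) + 0) sub0r opprK addr0.
by rewrite opprB subrK.
Qed.

(** The last hypothesis matches norms at the deeper level [k + t], where a cochain of period [p ^ k]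
    has [p ^ t] times its norm at level [k]; the norm [phi] itself need not be a norm of a cocycle
    at level [k]. *)
Lemma equivariant_primitive_of_class n F :
  X F -> supp n.+3 F -> dlt F = 0 -> (forall a, tw a F = F) ->
  (forall k phi, X phi -> supp n.+1 phi -> dlt phi = 0 -> tw sg phi = phi ->
    exists t w, [/\ X w, supp n.+1 w, dlt w = 0 &
      phi *+ p ^ t = nrm (p ^ (k + t)) w]) ->
  exists h, [/\ X h, supp n.+2 h, forall a, tw a h = h & dlt h = F].
Proof.
move=> XF sF dF FA W.
have [h [Xh sh dh]] := X_exact XF sF dF.
pose y := tw sg h - h.
have Xy : X y by apply: X_sub => //; apply: X_tw.
have sy : supp n.+2 y by apply: suppB => //; apply: supp_tw.
have dy : dlt y = 0 by rewrite dltB dlt_tw // dh FA subrr.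
have [E [XE sE dE]] := X_exact Xy sy dy.
have [k1 hk] := X_fixed Xh; have [k2 Ek] := X_fixed XE.
pose k := maxn k1 k2.
have sgk j : (j <= k)%N -> pow_sub j (sg *+ p ^ k).
  by move=> jk; apply: (pow_sub_le jk); exists sg.
have {}hk : tw (sg *+ p ^ k) h = h by apply/hk/sgk/leq_maxl.
have {}Ek : tw (sg *+ p ^ k) E = E by apply/Ek/sgk/leq_maxr.
pose phi := nrm (p ^ k) E.
(* The norm kills [y = tw sg h - h], because [h] is fixed by [sg *+ p ^ k]. *)
have dphi : dlt phi = 0.
  rewrite dlt_nrm dE nrmB -[nrm _ (tw _ _)]/(nrm _ (tw sg h)).
  have := tw_nrm (p ^ k) h; rewrite hk subrr => <-; congr (_ - _).
  by rewrite tw_sum //; apply: eq_bigr => i _; apply: twC.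
have phisg : tw sg phi = phi.
  by apply: subr0_eq; rewrite tw_nrm Ek subrr.
have [t [w [Xw sw dw phiw]]] := W k phi (X_nrm _ XE) (supp_nrm _ sE) dphi phisg.
have NE : nrm (p ^ (k + t)) (E - w) = 0.
  by rewrite nrmB -phiw expnD nrm_periodic // subrr.
have [E' [XE' sE' E'E]] := tw_sg_surj (X_sub XE Xw) (suppB sE sw) NE.
have Xh' : X (h - dlt E') by apply: X_sub => //; apply: X_dlt.
exists (h - dlt E'); split=> //.
- by apply: suppB => //; apply: supp_dlt.
- apply: X_fixed_sg => //; apply: subr0_eq.
  rewrite twB // -dlt_tw // (_ : _ - _ = y - (dlt (tw sg E') - dlt E')).
    by rewrite -dltB E'E dltB dE dw subr0 subrr.
  by rewrite /y; zmod.
by rewrite dltB dlt_dlt subr0.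
Qed.

(** On cochains fixed by [sg] the norm is multiplication by its length, so [w] can be a multiple
    [phi *+ c]. By Euler's theorem [c] inverts [p ^ k] modulo the part of [m] prime to [p]; the
    factor [p ^ t] with [t = logn p m] takes care of the rest of [m]. *)
Lemma norm_divide_finite m : prime p -> (0 < m)%N -> (forall v : M, v *+ m = 0) ->
  forall n k phi, X phi -> supp n.+1 phi -> dlt phi = 0 -> tw sg phi = phi ->
    exists t w, [/\ X w, supp n.+1 w, dlt w = 0 &
      phi *+ p ^ t = nrm (p ^ (k + t)) w].
Proof.
move=> p_prime m0 Mm n k phi Xphi sphi dphi phisg.
have mE : m = (p ^ logn p m * m`_p^')%N by rewrite -p_part partnC.
pose c := ((p ^ k) ^ (totient m`_p^').-1)%N.
have Mmod (v : M) a b : a = b %[mod m] -> v *+ a = v *+ b.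
  move=> ab; rewrite (divn_eq a m) (divn_eq b m) ab !mulrnDr.
  by rewrite ![(_ * m)%N]mulnC !mulrnA Mm !mul0rn.
exists (logn p m), (phi *+ c); split.
- exact: X_mulrn.
- exact: suppMn.
- by rewrite raddfMn /= dphi mul0rn.
rewrite nrm_fixed; last by rewrite raddfMn /= phisg.
apply: funext => s; rewrite -mulrnA !natmulfctE; apply: Mmod.
have ck : (c * p ^ k = (p ^ k) ^ totient m`_p^')%N.
  by rewrite -expnSr prednK // totient_gt0 part_gt0.
have mod_m a : (p ^ logn p m * a %% m = p ^ logn p m * (a %% m`_p^'))%N.
  by rewrite muln_modr -mE.
rewrite expnD mulnA ck [(_ ^ totient _ * _)%N]mulnC -{1}[(p ^ logn p m)%N]muln1 !mod_m.
rewrite Euler_exp_totient // coprimeXl // prime_coprime //.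
by rewrite -p'natE // part_pnat.
Qed.

(** Write [phi] as the coboundary of [G]. Its norm [psi] is fixed by [sg] and has coboundary
    [phi *+ p ^ t]. Cutting [psi] down to first entries of residue 0 gives [u], whose translates
    reassemble [psi]; hence [dlt u] is the required cocycle. *)
Lemma norm_divide n : forall k phi, X phi -> supp n.+2 phi -> dlt phi = 0 ->
  tw sg phi = phi ->
  exists t w, [/\ X w, supp n.+2 w, dlt w = 0 &
    phi *+ p ^ t = nrm (p ^ (k + t)) w].
Proof.
move=> k phi Xphi sphi dphi phisg.
have [G [XG sG dG]] := X_exact Xphi sphi dphi.
have [t GU] := X_fixed XG.
have {}GU : tw (sg *+ p ^ t) G = G by apply: GU; exists sg.
pose psi := nrm (p ^ t) G.
have psisg : tw sg psi = psi by apply: subr0_eq; rewrite tw_nrm GU subrr.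
have dpsi : dlt psi = phi *+ p ^ t by rewrite dlt_nrm dG nrm_fixed.
pose u : seq A -> M := fun s => if (rs (k + t) (head 0%R s) == 0)%N then psi s else 0.
have spsi : supp n.+1 psi by apply: supp_nrm.
have su : supp n.+1 u.
  by move=> s ss; rewrite /u spsi ?if_same.
exists t, (dlt u); split.
- by apply: X_dlt; apply: (X_if _ (fun r => r == 0)%N); apply: X_nrm.
- exact: supp_dlt.
- exact: dlt_dlt.
rewrite -dpsi -dlt_nrm; congr dlt; apply: funext => -[|x s].
  by rewrite spsi // (supp_nrm _ su).
(* Only the translate of [u] indexed by the residue of the first entry can be nonzero here. *)
rewrite /nrm fct_sumE (bigD1 (Ordinal (rs_lt (k + t) x))) //= big1 => [|i].
  rewrite addr0 {1}/twist /u /= rs_sub_eq0 // eqxx.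
  rewrite -[RHS]/(tw _ psi (x :: s)).
  by rewrite (subgroupMn _ (subgroup_stab al_0 al_act psi)).
rewrite -val_eqE /= => ne; rewrite /twist /u /= rs_sub_eq0 // (negPf ne).
have := al_add (sg *+ i) 0 0; rewrite addr0 => /esym/eqP.
by rewrite -subr_eq0 addrK => /eqP.
Qed.

End Class.

Lemma al_zero a : al a 0 = 0.
Proof. by apply: (addrI (al a 0)); rewrite -al_add !addr0. Qed.

Lemma rs_le j k x y : (j <= k)%N -> rs k x = rs k y -> rs j x = rs j y.
Proof. by move=> jk /rs_eq h; apply/rs_eq; apply: pow_sub_le h. Qed.

Lemma rs_sub k x y : pow_sub k x -> rs k (y - x) = rs k y.
Proof.
move=> kx; apply/rs_eq; rewrite [X in pow_sub _ X](_ : _ = - x); last by zmod.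
exact: subgroupN (subgroup_pow_sub k) kx.
Qed.

(** * Cochains fixed by an open subgroup, and locally constant cochains *)

Definition open_fixed F := exists k, forall x, pow_sub k x -> tw x F = F.

Lemma open_fixed_sub F E : open_fixed F -> open_fixed E -> open_fixed (F - E).
Proof.
move=> [j Fj] [k Ek]; exists (maxn j k) => x jk; rewrite twB // Fj ?Ek //.
  by apply: pow_sub_le jk; apply: leq_maxr.
by apply: pow_sub_le jk; apply: leq_maxl.
Qed.

Lemma open_fixed_dlt F : open_fixed F -> open_fixed (dlt F).
Proof. by move=> [k Fk]; exists k => x kx; rewrite -dlt_tw // Fk. Qed.

Lemma open_fixed_tw F : open_fixed F -> open_fixed (tw sg F).
Proof. by move=> [k Fk]; exists k => x kx; rewrite twC // Fk. Qed.

Lemma open_fixed_if k (P : pred nat) F : open_fixed F ->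
  open_fixed (fun s => if P (rs k (head 0 s)) then F s else 0).
Proof.
move=> [j Fj]; exists (maxn j k) => x jk.
have kx : pow_sub k x by apply: pow_sub_le jk; apply: leq_maxr.
have {}Fj : tw x F = F by apply: Fj; apply: pow_sub_le jk; apply: leq_maxl.
apply: funext => s; rewrite /twist.
have -> : rs k (head 0 (shift x s)) = rs k (head 0 s).
  by case: s => [|y s] //=; apply: rs_sub.
by case: ifP => _; rewrite ?al_zero // -[in RHS]Fj.
Qed.

(** Local constancy is uniform: one level serves all lists. *)
Definition loc_const F := exists k, forall s t,
  [seq rs k x | x <- s] = [seq rs k x | x <- t] -> F s = F t.

Lemma map_rs_le j k s t : (j <= k)%N ->
  [seq rs k x | x <- s] = [seq rs k x | x <- t] ->
  [seq rs j x | x <- s] = [seq rs j x | x <- t].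
Proof.
move=> jk; elim: s t => [|x s IH] [|y t] //= [xy /IH ->].
by rewrite (rs_le jk xy).
Qed.

Lemma loc_const_sub F E : loc_const F -> loc_const E -> loc_const (F - E).
Proof.
move=> [j Fj] [k Ek]; exists (maxn j k) => s t st; rewrite !fctB.
congr (_ - _); [apply: Fj|apply: Ek]; apply: map_rs_le st.
  exact: leq_maxl.
exact: leq_maxr.
Qed.

Lemma loc_const_dlt F : loc_const F -> loc_const (dlt F).
Proof.
move=> [k Fk]; exists k => s t.
(* Two functions are compared, because the slices at [x] and at [y] are distinct cochains. *)
suff gen E : (forall u v, [seq rs k x | x <- u] = [seq rs k x | x <- v] ->
    F u = E v) -> [seq rs k x | x <- s] = [seq rs k x | x <- t] ->
    dlt F s = dlt E t by exact: gen.
elim: s t F {Fk} E => [|x s IH] [|y t] F E FE // [xy st].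
rewrite !dlt_cons (FE _ _ st) (IH t _ (slice y E)) // => u v uv.
by apply: FE; rewrite /= xy uv.
Qed.

Lemma loc_const_tw F : loc_const F -> loc_const (tw sg F).
Proof.
move=> [k Fk]; exists k => s t st; congr (al sg _); apply: Fk.
elim: s t st => [|x s IH] [|y t] //= [/rs_eq xy /IH ->]; congr (_ :: _).
by apply/rs_eq; rewrite [X in pow_sub _ X](_ : _ = x - y) //; zmod.
Qed.

Lemma loc_const_if k (P : pred nat) F : loc_const F ->
  loc_const (fun s => if P (rs k (head 0 s)) then F s else 0).
Proof.
move=> [j Fj]; exists (maxn j k) => s t st.
rewrite (Fj s t); last by apply: map_rs_le st; apply: leq_maxl.
suff -> : rs k (head 0 s) = rs k (head 0 t) by [].
have := map_rs_le (leq_maxr j k) st.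
by case: s t {st} => [|x s] [|y t] //= [].
Qed.

(** Translating the contraction at 0 by [x] gives the contraction at [x], since [F] is fixed; for
    [x] in a small enough open subgroup the two agree by local constancy. *)
Lemma loc_const_exact n F : loc_const F /\ open_fixed F -> supp n.+2 F ->
  dlt F = 0 -> exists h, [/\ loc_const h /\ open_fixed h, supp n.+1 h & dlt h = F].
Proof.
move=> [[j Fj] [k Fk]] sF dF; exists (slice 0 F); split; last exact: dlt_slice.
  split; first by exists j => s t st; apply: Fj; rewrite /= st.
  exists (maxn j k) => x jk; apply: funext => s; rewrite /slice /twist.
  have jx : pow_sub j x by apply: pow_sub_le jk; apply: leq_maxl.
  rewrite -[0](subrr x) -[_ :: _]/(shift x (x :: s)) -[LHS]/(tw x F (x :: s)).
  rewrite Fk; last by apply: pow_sub_le jk; apply: leq_maxr.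
  by apply: Fj; rewrite /= subrr -(rs_sub x jx) subrr.
exact: supp_slice.
Qed.

Section LocConst.
Let X F := loc_const F /\ open_fixed F.

Let X_sub F E : X F -> X E -> X (F - E).
Proof. by move=> [F1 F2] [E1 E2]; split; [apply: loc_const_sub|apply: open_fixed_sub]. Qed.
Let X_dlt F : X F -> X (dlt F).
Proof. by move=> [F1 F2]; split; [apply: loc_const_dlt|apply: open_fixed_dlt]. Qed.
Let X_tw F : X F -> X (tw sg F).
Proof. by move=> [F1 F2]; split; [apply: loc_const_tw|apply: open_fixed_tw]. Qed.
Let X_if k (P : pred nat) F : X F ->
  X (fun s => if P (rs k (head 0 s)) then F s else 0).
Proof. by move=> [F1 F2]; split; [apply: loc_const_if|apply: open_fixed_if]. Qed.
Let X_fixed F : X F -> open_fixed F.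
Proof. by case. Qed.

Lemma loc_const_primitive_finite m n F :
  prime p -> (0 < m)%N -> (forall v : M, v *+ m = 0) ->
  loc_const F -> supp n.+3 F -> dlt F = 0 -> (forall a, tw a F = F) ->
  exists h, [/\ loc_const h, supp n.+2 h, forall a, tw a h = h & dlt h = F].
Proof.
move=> p_prime m0 Mm lF sF dF FA.
have XF : X F by split=> //; exists 0%N.
have := equivariant_primitive_of_class X_sub X_dlt X_tw X_if X_fixed
  loc_const_exact XF sF dF FA.
move=> /(_ (norm_divide_finite X_sub p_prime m0 Mm (n := n))).
by move=> [h [[lh _] sh hA dh]]; exists h.
Qed.

(** For general [M] the correction comes from [norm_divide], which needs a primitive of [phi] and so
    costs one degree compared with the finite case. *)
Lemma loc_const_primitive n F :
  loc_const F -> supp n.+4 F -> dlt F = 0 -> (forall a, tw a F = F) ->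
  exists h, [/\ loc_const h, supp n.+3 h, forall a, tw a h = h & dlt h = F].
Proof.
move=> lF sF dF FA.
have XF : X F by split=> //; exists 0%N.
have := equivariant_primitive_of_class X_sub X_dlt X_tw X_if X_fixed
  loc_const_exact XF sF dF FA.
move=> /(_ (norm_divide X_sub X_dlt X_tw X_if X_fixed loc_const_exact (n := n))).
by move=> [h [[lh _] sh hA dh]]; exists h.
Qed.

End LocConst.
End Procyclic.

(** * Equivariant primitives of abstract cochains *)

Lemma finZmod_mulrn_card (M : finZmodType) (v : M) : v *+ #|M| = 0.
Proof.
rewrite -FinRing.zmodXgE -cardsT.
by apply/eqP; rewrite -order_dvdn order_dvdG ?inE.
Qed.

(** The part of [m] prime to [p] divides every element, so only the power of [p] in [m] deepens the
    level. *)
Lemma pow_sub_mulrn (A : zmodType) (p m k : nat) (x : A) :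
  prime p -> (0 < m)%N ->
  (forall m' (y : A), coprime p m' -> exists z, y = z *+ m') ->
  pow_sub p (k + logn p m) x -> exists z, x = z *+ (p ^ k * m).
Proof.
move=> p_prime m0 div [y ->]; have [|z ->] := div (m`_p^')%N y.
  by rewrite prime_coprime // -p'natE // part_pnat.
exists z; rewrite -mulrnA; congr (z *+ _).
by rewrite expnD -p_part mulnC -mulnA partnC.
Qed.

Lemma abstract_primitive (A : zmodType) (p : nat) (sg : A) (rs : nat -> A -> nat)
    (M : finZmodType) (al : A -> M -> M) :
  prime p -> (forall k x, (rs k x < p ^ k)%N) ->
  (forall k x y, rs k x = rs k y <-> pow_sub p k (x - y)) ->
  (forall k i, rs k (sg *+ i) = (i %% p ^ k)%N) ->
  (forall (x : A) (k : int), x *~ k = 0 -> k != 0 -> x = 0) ->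
  (forall m (x : A), coprime p m -> exists y, x = y *+ m) ->
  (forall a x y, al a (x + y) = al a x + al a y) ->
  (forall x, al 0 x = x) ->
  (forall a b x, al (a + b) x = al a (al b x)) ->
  (exists k, forall a v, pow_sub p k a -> al a v = v) ->
  forall n F, supp n.+3 F -> dlt F = 0 -> (forall a, twist al a F = F) ->
  exists h, [/\ supp n.+2 h, forall a, twist al a h = h & dlt h = F].
Proof.
move=> p_prime rs_lt rs_eq rs_sg tfree div al_add al_0 al_act [k0 al_triv] n F sF dF FA.
have p_gt1 := prime_gt1 p_prime.
pose m := #|M|; have m0 : (0 < m)%N by apply/card_gt0P; exists 0.
have Mm (v : M) : v *+ m = 0 by exact: finZmod_mulrn_card.
(* The level of [q] is deep enough to act trivially on [M] and to fix [E]; by [pow_sub_mulrn] the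
   primitive is then fixed by an open subgroup. *)
have X_exact n' E : open_fixed p al E -> supp n'.+2 E -> dlt E = 0 ->
    exists h, [/\ open_fixed p al h, supp n'.+1 h & dlt h = E].
  move=> [k Ek] sE dE; pose q := (p ^ maxn k0 k)%N.
  have powq j (x : A) : (j <= maxn k0 k)%N -> pow_sub p j (x *+ q).
    by move=> jk; apply: (pow_sub_le jk); exists x.
  have q0 : (0 < q)%N by rewrite expn_gt0 prime_gt0.
  have [h [sh hqm dh]] := equivariant_primitive al_add al_0 al_act tfree q0 m0 Mm
    (fun a v => al_triv _ _ (powq _ _ (leq_maxl _ _)))
    (fun a => Ek _ (powq _ _ (leq_maxr _ _))) sE dE.
  exists h; split=> //; exists (maxn k0 k + logn p m)%N => x.
  by move=> /(pow_sub_mulrn p_prime m0 div) [z ->].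
have XF : open_fixed p al F by exists 0%N.
have X_sub E G : open_fixed p al E -> open_fixed p al G -> open_fixed p al (E - G).
  exact: open_fixed_sub.
have X_dlt E : open_fixed p al E -> open_fixed p al (dlt E).
  exact: open_fixed_dlt.
have X_tw E : open_fixed p al E -> open_fixed p al (twist al sg E).
  exact: open_fixed_tw.
have X_if k (P : pred nat) E : open_fixed p al E ->
    open_fixed p al (fun s => if P (rs k (head 0 s)) then E s else 0).
  exact: (open_fixed_if rs_eq).
have := equivariant_primitive_of_class p_gt1 rs_lt rs_eq rs_sg al_add al_0 al_act
  X_sub X_dlt X_tw X_if (fun E h => h) X_exact XF sF dF FA.
move=> /(_ (@norm_divide_finite _ _ _ _ _ al_add al_0 al_act _ X_sub m p_prime m0 Mm n)).
by move=> [h [_ sh hA dh]]; exists h.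
Qed.

(** * The p-adic integers *)

Section Padic.
Variable p : nat.
Implicit Types x y z : padic p.

Lemma zp_eqP x y : (forall n, proj1_sig x n = proj1_sig y n) -> x = y.
Proof.
case: x y => [x xc] [y yc] /= xy; have {}xy : x = y by apply: funext.
by case: _ / xy in yc *; congr exist; apply: Prop_irrelevance.
Qed.

Lemma zp_mod_le x j n : (j <= n)%N -> (proj1_sig x n %% ppow p j)%Z = proj1_sig x j.
Proof.
elim: n => [|n IH].
  by rewrite leqn0 => /eqP ->; rewrite -(proj2_sig x 0%N) modz_mod.
rewrite leq_eqVlt => /predU1P[->|]; first by rewrite -(proj2_sig x n.+1) modz_mod.
rewrite ltnS => jn; rewrite -(IH jn) -(proj2_sig x n) modz_dvd_mod //.
by rewrite /dvdz /ppow /= dvdn_exp2l.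
Qed.

Lemma zp_modK x n : (proj1_sig x n %% ppow p n)%Z = proj1_sig x n.
Proof. exact: zp_mod_le. Qed.

Lemma padic_addA : associative (@Defs.Zp_add p).
Proof. by move=> x y z; apply: zp_eqP => n /=; rewrite modzDmr modzDml addrA. Qed.
Lemma padic_addC : commutative (@Defs.Zp_add p).
Proof. by move=> x y; apply: zp_eqP => n /=; rewrite addrC. Qed.
Lemma padic_add0 : left_id (Defs.Zp_zero p) (@Defs.Zp_add p).
Proof. by move=> x; apply: zp_eqP => n /=; rewrite add0r zp_modK. Qed.
Lemma padic_addN : left_inverse (Defs.Zp_zero p) (@Defs.Zp_opp p) (@Defs.Zp_add p).
Proof. by move=> x; apply: zp_eqP => n /=; rewrite modzDml addNr mod0z. Qed.

HB.instance Definition _ := gen_eqMixin (padic p).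
HB.instance Definition _ := gen_choiceMixin (padic p).
HB.instance Definition _ :=
  GRing.isZmodule.Build (padic p) padic_addA padic_addC padic_add0 padic_addN.

Lemma zp_addE x y n :
  proj1_sig (x + y) n = ((proj1_sig x n + proj1_sig y n) %% ppow p n)%Z.
Proof. by []. Qed.

Lemma zp_subE x y n :
  proj1_sig (x - y) n = ((proj1_sig x n - proj1_sig y n) %% ppow p n)%Z.
Proof. by rewrite zp_addE /= modzDmr. Qed.

Lemma zp_mulrnE x m n : proj1_sig (x *+ m) n = ((proj1_sig x n * m%:Z) %% ppow p n)%Z.
Proof.
elim: m => [|m IH]; first by rewrite mulr0 mod0z.
by rewrite mulrS zp_addE IH modzDmr -addn1 PoszD mulrDr mulr1 addrC.
Qed.

Lemma zp_one_compat : Zp_compat p (fun n => (1 %% ppow p n)%Z).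
Proof. by move=> n; rewrite modz_dvd_mod ?ppow_dvd. Qed.

Definition zp_one : padic p := exist _ _ zp_one_compat.
Definition residue k x : nat := absz (proj1_sig x k).

Hypothesis p_prime : prime p.

Lemma ppow_gt0 n : 0 < ppow p n.
Proof. by rewrite /ppow ltz_nat expn_gt0 prime_gt0. Qed.

Lemma ppow_neq0 n : ppow p n != 0.
Proof. exact: lt0r_neq0 (ppow_gt0 n). Qed.

Lemma residueE k x : (residue k x)%:Z = proj1_sig x k.
Proof. by rewrite gez0_abs // -zp_modK modz_ge0 // ppow_neq0. Qed.

Lemma residue_lt k x : (residue k x < p ^ k)%N.
Proof. by rewrite -ltz_nat residueE -zp_modK ltz_pmod // ppow_gt0. Qed.

Lemma residue_one k i : residue k (zp_one *+ i) = (i %% p ^ k)%N.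
Proof.
by apply/eqP; rewrite -eqz_nat residueE zp_mulrnE /= modzMml mul1r modz_nat.
Qed.

Lemma residueP k x y : residue k x = residue k y <-> proj1_sig x k = proj1_sig y k.
Proof. by rewrite -!residueE; split=> [->|[]]. Qed.

Lemma zp_limit (u : nat -> padic p) :
  (forall k, residue k (u k.+1) = residue k (u k)) ->
  exists x, forall k, residue k x = residue k (u k).
Proof.
move=> uc; have xc : Zp_compat p (fun n => proj1_sig (u n) n).
  by move=> n; rewrite (zp_mod_le (u n.+1) (leqnSn n)); apply/residueP.
by exists (exist _ _ xc).
Qed.

(** The quotient is read [k] levels higher: its component [n] is that of [x] at [n + k], divided by
    [p ^ k]. *)
Lemma zp_divides k x : proj1_sig x k = 0 -> exists y, x = y *+ (p ^ k)%N.
Proof.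
move=> xk0.
have xdvd n : proj1_sig x (n + k)%N = (proj1_sig x (n + k)%N %/ ppow p k)%Z * ppow p k.
  apply/esym/divzK/dvdz_mod0P.
  by rewrite zp_mod_le ?leq_addl.
have yc : Zp_compat p (fun n => (proj1_sig x (n + k)%N %/ ppow p k)%Z).
  move=> n; apply: (mulIf (ppow_neq0 k)); rewrite -xdvd.
  have -> : proj1_sig x (n + k)%N = (proj1_sig x (n.+1 + k)%N %% ppow p (n + k))%Z.
    by rewrite zp_mod_le ?leq_add2r.
  rewrite [X in (X %% ppow p (n + k))%Z]xdvd.
  rewrite (_ : ppow p (n + k) = ppow p n * ppow p k); last by rewrite /ppow expnD.
  by rewrite /modz divzMpr ?ppow_gt0 //; ring.
exists (exist _ _ yc); apply: zp_eqP => n.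
by rewrite zp_mulrnE /= -/(ppow p k) -xdvd zp_mod_le ?leq_addr.
Qed.

Lemma residue_eq k x y : residue k x = residue k y <-> pow_sub p k (x - y).
Proof.
split=> [/residueP xy|[z xy]].
  by apply: zp_divides; rewrite zp_subE xy subrr mod0z.
apply/residueP; rewrite -[x](subrK y) xy zp_addE zp_mulrnE.
by rewrite -/(ppow p k) modzMl add0r zp_modK.
Qed.

(** Multiplication by [m] loses at most [logn p m] levels, so component [n] is controlled from level
    [n + logn p m]. *)
Lemma zp_torsion_free x (k : int) : x *~ k = 0 -> k != 0 -> x = 0.
Proof.
suff nat_case m : (0 < m)%N -> x *+ m = 0 -> x = 0.
  case: k => m; first by move=> xm m0; apply: (nat_case m); rewrite // lt0n.
  by rewrite NegzE mulrNz => /eqP; rewrite oppr_eq0 => /eqP xm _; apply: nat_case xm.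
move=> m0 xm; apply: zp_eqP => n; set a := logn p m.
rewrite -(zp_mod_le x (leq_addr a n)) /=; apply/dvdz_mod0P.
have : (ppow p (n + a) %| proj1_sig x (n + a)%N * m)%Z.
  by apply/dvdz_mod0P; rewrite -zp_mulrnE xm.
rewrite -[X in _ * X%:Z](partnC p m0) p_part -/a PoszM mulrA Gauss_dvdzl; last first.
  rewrite coprimezE /= coprimeXl // prime_coprime //.
  by rewrite -p'natE // part_pnat.
by rewrite /ppow expnD PoszM dvdz_mul2r // ppow_neq0.
Qed.

(** Inverses of [m] modulo each [p ^ n] are chosen separately; compatibility of the quotients
    follows by cancelling [m]. *)
Lemma zp_divides_coprime m x : coprime p m -> exists y, x = y *+ m.
Proof.
move=> pm.
have inv n : exists c : int, (ppow p n %| c * m - 1)%Z.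
  have [u [v uv]] := Bezoutz m (ppow p n); exists u.
  have g1 : gcdz m (ppow p n) = 1.
    by rewrite /gcdz /= (eqP (_ : coprime m (p ^ n))) // coprimeXr // coprime_sym.
  rewrite (_ : _ - _ = (- v) * ppow p n) ?dvdz_mull // -[X in _ - X]g1 -uv; ring.
have [c cP] := choice inv.
have cancel n (a : int) : (ppow p n %| a * m)%Z -> (ppow p n %| a)%Z.
  by rewrite Gauss_dvdzl // coprimezE /= coprimeXl.
have yc : Zp_compat p (fun n => (proj1_sig x n * c n %% ppow p n)%Z).
  move=> n; rewrite modz_dvd_mod ?ppow_dvd //; apply/eqP; rewrite eqz_mod_dvd.
  apply: cancel; rewrite (_ : _ * _ =
    proj1_sig x n.+1 * (c n.+1 * m - 1) - proj1_sig x n * (c n * m - 1)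
    + (proj1_sig x n.+1 - proj1_sig x n)); last by ring.
  apply: rpredD; first apply: rpredB.
  - by rewrite dvdz_mull // (dvdz_trans (ppow_dvd p n)).
  - by rewrite dvdz_mull.
  by rewrite -eqz_mod_dvd (proj2_sig x n) zp_modK.
exists (exist _ _ yc); apply: zp_eqP => n.
rewrite zp_mulrnE /= modzMml -[LHS]zp_modK; apply/eqP; rewrite eqz_mod_dvd.
rewrite (_ : _ - _ = - (proj1_sig x n * (c n * m - 1))); last by ring.
by rewrite rpredN dvdz_mull.
Qed.

End Padic.

(** * Inhomogeneous cochains *)

Section PartialSums.
Variables (A M : zmodType).
Implicit Types (a x : A) (u : seq A) (F : seq A -> M).

(** [psums] and [diffs] pass between inhomogeneous coordinates with a base point [a] and homogeneous
    ones. *)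
Definition psums a u := a :: scanl +%R a u.
Definition diffs a u := pairmap (fun x y => y - x) a u.

Lemma diffsK a u : diffs a (scanl +%R a u) = u.
Proof. by apply: (scanlK (f := fun x y => y - x)) => x y; rewrite addrC addKr. Qed.

Lemma psumsK a u : psums a (diffs a u) = a :: u.
Proof.
congr (_ :: _); apply: (pairmapK (g := +%R)) => x y.
by rewrite addrC subrK.
Qed.

Fixpoint merge_at k u : seq A :=
  match k, u with
  | 0%N, x :: y :: u' => (x + y) :: u'
  | k'.+1, x :: u' => x :: merge_at k' u'
  | _, _ => u
  end.

Lemma nth_merge_at k u i : (k.+1 < size u)%N ->
  (merge_at k u)`_i =
  if (i < k)%N then u`_i else if (i == k)%N then u`_i + u`_i.+1 else u`_i.+1.
Proof.
elim: k u i => [|k IH] [|x [|y u]] [|i] // h.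
by rewrite [LHS]/= IH.
Qed.

Lemma size_merge_at k u : (k.+1 < size u)%N -> size (merge_at k u) = (size u).-1.
Proof.
by elim: k u => [|k IH] [|x [|y u]] // h; rewrite /= IH.
Qed.

Lemma sgnS k (v : M) : sgn k.+1 v = - sgn k v.
Proof. by rewrite /sgn /=; case: odd => //; rewrite opprK. Qed.

(** Omitting the first vertex moves the base point, omitting an inner one merges two consecutive
    increments, and omitting the last truncates. *)
Lemma dlt_psums F a x u s : size u = s ->
  dlt F (psums a (x :: u)) = F (psums (a + x) u)
    + \sum_(k < s) sgn k.+1 (F (psums a (merge_at k (x :: u))))
    + sgn s.+1 (F (psums a (take s (x :: u)))).
Proof.
move=> <-; elim: u F a x => [|y u IH] F a x.
  rewrite big_ord0 addr0.
  exact: (congr1 (fun z => F [:: a + x] - z) (subr0 (F [:: a]))).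
rewrite -[psums a _]/(a :: psums (a + x) (y :: u)) dlt_cons IH.
rewrite big_ord_recl [X in _ = _ + _ + X]sgnS.
rewrite [X in _ + (_ + X)](_ : _ = - \sum_(k < size u)
   sgn k.+1 (slice a F (psums (a + x) (merge_at k (y :: u))))).
  have -> : sgn (@ord0 (size u)).+1
      (F (psums a (merge_at (@ord0 (size u)) [:: x, y & u]))) =
      - slice a F (psums (a + x + y) u) by rewrite /sgn /slice /psums /= addrA.
  rewrite -[X in _ = _ + _ - X]/(sgn (size u).+1
    (slice a F (psums (a + x) (take (size u) (y :: u))))).
  zmod.
by rewrite -sumrN; apply: eq_bigr => i _; rewrite sgnS.
Qed.

End PartialSums.

Section Inhomogeneous.
Variables (P : topgrp) (A : zmodType) (e : P -> A) (io : A -> P).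
Hypothesis eK : cancel e io.
Hypothesis ioK : cancel io e.
Hypothesis eM : forall g h, e (gmul g h) = e g + e h.
Variables (M : zmodType) (act : P -> M -> M).
Let al a := act (io a).
Hypothesis al_add : forall a x y, al a (x + y) = al a x + al a y.
Hypothesis al_0 : forall x, al 0 x = x.
Hypothesis al_act : forall a b x, al (a + b) x = al a (al b x).

Lemma map_tmerge s (t : s.+1.-tuple P) (k : 'I_s) :
  map e (tmerge t k) = merge_at k (map e t).
Proof.
have st : size (map e t) = s.+1 by rewrite size_map size_tuple.
apply: (@eq_from_nth _ 0); first by rewrite size_merge_at st ?ltnS // size_map size_tuple.
move=> i; rewrite size_map size_tuple => lt_is.
rewrite nth_merge_at ?st ?ltnS // !(nth_map (gone P)) ?size_tuple ?ltnS ?(ltnW lt_is) //.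
rewrite -(tnth_nth _ _ (Ordinal lt_is)) tnth_mktuple.
rewrite !(tnth_nth (gone P)) /= /bump /= add1n.
by case: ifP => // _; case: ifP => // _; rewrite eM.
Qed.

Lemma map_tdrop_last s (t : s.+1.-tuple P) : map e (tdrop_last t) = take s (map e t).
Proof.
apply: (@eq_from_nth _ 0).
  by rewrite size_map size_tuple size_takel // size_map size_tuple.
move=> i; rewrite size_map size_tuple => lt_is.
rewrite nth_take // !(nth_map (gone P)) ?size_tuple ?(ltnW lt_is) //; last exact: ltnW.
rewrite -(tnth_nth _ _ (Ordinal lt_is)) tnth_mktuple.
by rewrite !(tnth_nth (gone P)).
Qed.

Definition inhom (H : seq A -> M) s : s.-tuple P -> M :=
  fun t => H (psums 0 (map e t)).

(* [(x_0, .., x_s) |-> x_0 . f (x_1 - x_0, .., x_s - x_(s-1))]; [insub] fails only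
   on lists of the wrong length. *)
Definition homog s (f : s.-tuple P -> M) : seq A -> M :=
  fun l => if l is a :: r then
    if insub (map io (diffs a r)) is Some t then al a (f t) else 0
  else 0.

Lemma homogE s (f : s.-tuple P -> M) a (t : s.-tuple P) :
  homog f (psums a (map e t)) = al a (f t).
Proof. by rewrite /homog /psums diffsK mapK // valK. Qed.

Lemma supp_homog s (f : s.-tuple P -> M) : supp s.+1 (homog f).
Proof.
move=> [|a r] //; rewrite /= eqSS => sr.
by rewrite insubF // size_map size_pairmap; apply: negPf.
Qed.

Lemma inhom_homog s (f : s.-tuple P -> M) : inhom (homog f) (s := s) = f.
Proof. by apply: funext => t; rewrite /inhom homogE al_0. Qed.

Lemma psums_surj s l : size l = s.+1 ->
  exists a (t : s.-tuple P), l = psums a (map e t).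
Proof.
case: l => // a r [sr]; have st : size (map io (diffs a r)) == s.
  by rewrite size_map size_pairmap sr.
by exists a, (Tuple st); rewrite -map_comp (eq_map ioK) map_id psumsK.
Qed.

Lemma shift_psums (b a : A) u : shift b (psums a u) = psums (a - b) u.
Proof.
rewrite /psums /=; congr (_ :: _); elim: u a => [|x u IH] a //=.
by rewrite IH addrAC.
Qed.

Lemma tw_homog s (f : s.-tuple P -> M) b : twist al b (homog f) = homog f.
Proof.
apply: funext => l; have [sl|sl] := boolP (size l == s.+1).
  have [a [t ->]] := psums_surj (eqP sl).
  by rewrite /twist shift_psums !homogE -al_act addrC subrK.
by rewrite !(supp_homog _, supp_tw al_add _ (supp_homog f)).
Qed.

Lemma inhom_eq0 s (G : seq A -> M) : supp s.+1 G -> (forall a, twist al a G = G) ->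
  (forall t : s.-tuple P, inhom G t = 0) -> G = 0.
Proof.
move=> sG GA G0; apply: funext => l; have [sl|sl] := boolP (size l == s.+1).
  have [a [t ->]] := psums_surj (eqP sl).
  rewrite -(GA a) /twist shift_psums subrr [G _](G0 t).
  by apply: (al_zero al_add).
exact: sG.
Qed.

Lemma cobound_inhom (H : seq A -> M) s (t : s.+1.-tuple P) :
  (forall a, twist al a H = H) ->
  cobound act (inhom H (s := s)) t = dlt H (psums 0 (map e t)).
Proof.
move=> HA; have : size (behead_tuple t) = s by rewrite size_tuple.
have te : map e t = e (thead t) :: map e (behead_tuple t).
  by rewrite {1}[t]tuple_eta.
rewrite -(size_map e) => sb; rewrite [in RHS]te (dlt_psums _ _ _ sb) -te /cobound.
rewrite /inhom -map_tdrop_last; congr (_ + _ + _).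
  (* Equivariance moves the base point back to 0, which produces the action in the first term of
     [cobound]. *)
  rewrite add0r -[in RHS](HA (e (thead t))) /twist shift_psums subrr.
  by rewrite /al eK.
by apply: eq_bigr => k _; rewrite map_tmerge.
Qed.

Lemma dlt_homog s (f : s.-tuple P -> M) : is_cocycle act f -> dlt (homog f) = 0.
Proof.
move=> fc; apply: (@inhom_eq0 s.+1).
- exact: supp_dlt (supp_homog f).
- by move=> a; rewrite -dlt_tw // tw_homog.
move=> t; rewrite /inhom -cobound_inhom; last exact: tw_homog.
by rewrite inhom_homog fc.
Qed.

Lemma cobound_of_primitive s (f : s.+1.-tuple P -> M) h :
  (forall a, twist al a h = h) -> dlt h = homog f ->
  forall t, f t = cobound act (inhom h (s := s)) t.
Proof.
by move=> hA dh t; rewrite cobound_inhom // dh homogE al_0.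
Qed.

End Inhomogeneous.

(** * Cohomology of the p-adic integers *)

Lemma bounded_choice (T : finType) (Q : T -> nat -> Prop) :
  (forall c, exists k, Q c k) -> exists K, forall c, exists2 k, (k <= K)%N & Q c k.
Proof.
move=> /choice [k kP]; exists (\max_c k c)%N => c.
by exists (k c) => //; apply: leq_bigmax.
Qed.

(** Transfers local constancy between homogeneous and inhomogeneous coordinates at the same
    level. *)
Lemma residues_psums (p k : nat) (a b : padic p) u v : prime p ->
  [seq residue k x | x <- psums a u] = [seq residue k x | x <- psums b v] <->
  residue k a = residue k b /\ [seq residue k x | x <- u] = [seq residue k x | x <- v].
Proof.
move=> p_prime; have rs_eq := @residue_eq p p_prime k.
have sub_pow : subgroup (@pow_sub (padic p) p k) by exact: subgroup_pow_sub.
elim: u v a b => [|x u IH] [|y v] a b //=; try by split=> [[]|[]].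
  by split=> [[->]|[->]].
have step : residue k a = residue k b ->
    residue k (a + x) = residue k (b + y) <-> residue k x = residue k y.
  move=> /rs_eq ab; rewrite !rs_eq; split=> h.
    rewrite (_ : x - y = a + x - (b + y) - (a - b)); last by zmod.
    exact: (proj2 sub_pow).
  by rewrite (_ : a + x - (b + y) = x - y + (a - b)); [apply: subgroupD|zmod].
split=> [ee|[ab [/(step ab) xy uv]]].
  have ab : residue k a = residue k b := congr1 (head 0%N) ee.
  have /IH [/(step ab) -> ->] : [seq residue k x | x <- psums (a + x) u] =
    [seq residue k x | x <- psums (b + y) v] := congr1 behead ee.
  by [].
by congr (_ :: _) => //; apply/(IH v (a + x) (b + y)).
Qed.

Section PadicGroup.
Variables (P : topgrp) (p : nat) (e : P -> padic p) (io : padic p -> P).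
Hypothesis p_prime : prime p.
Hypothesis eK : cancel e io.
Hypothesis ioK : cancel io e.
Hypothesis eM : forall g h, e (gmul g h) = e g + e h.
Hypothesis open_ball : forall (V : P -> Prop) g, gopen V -> V g ->
  exists k, forall h, residue k (e h) = residue k (e g) -> V h.
Hypothesis ball_open : forall k g,
  @gopen P (fun h => residue k (e h) = residue k (e g)).

Let rs_lt := residue_lt p_prime.
Let rs_eq := residue_eq p_prime.
Let rs_one := residue_one p_prime.

Definition residues k s (t : s.-tuple P) : seq nat := [seq residue k (e g) | g <- t].

Lemma residues_tnth k s (t u : s.-tuple P) :
  residues k t = residues k u <->
  forall i, residue k (e (tnth t i)) = residue k (e (tnth u i)).
Proof.
split=> [/(congr1 (fun r => nth 0%N r _)) tu i|tu].
  have := tu i; rewrite !(nth_map (gone P)) ?size_tuple //.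
  by rewrite -!tnth_nth.
apply: (@eq_from_nth _ 0%N); rewrite !size_map !size_tuple // => i lt_is.
by rewrite !(nth_map (gone P)) ?size_tuple // -!(tnth_nth _ _ (Ordinal lt_is)) tu.
Qed.

Lemma residues_le j k s (t u : s.-tuple P) : (j <= k)%N ->
  residues k t = residues k u -> residues j t = residues j u.
Proof.
move=> jk tu; have := @map_rs_le _ _ _ rs_eq j k (map e t) (map e u) jk.
by rewrite -!map_comp; apply.
Qed.

(** Total boundedness of [P ^ s]: the centres have multiples of 1 as coordinates. *)
Lemma residue_cover k s : exists R : {ffun 'I_s -> 'I_(p ^ k)} -> s.-tuple P,
  forall t : s.-tuple P, exists c, residues k t = residues k (R c).
Proof.
exists (fun c : {ffun 'I_s -> 'I_(p ^ k)} => [tuple io (zp_one p *+ c i) | i < s]) => t.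
exists [ffun i => Ordinal (rs_lt k (e (tnth t i)))].
apply/residues_tnth => i; rewrite tnth_mktuple ffunE ioK.
by rewrite rs_one modn_small ?rs_lt.
Qed.

(** * Uniform local constancy of continuous cochains *)

Section Continuity.
Variables (M : zmodType) (s : nat) (f : s.-tuple P -> M).
Hypothesis f_cont : cont_cochain f.

Lemma cont_cochain_ball t : exists k, forall u, residues k u = residues k t -> f u = f t.
Proof.
have [U [Ut Uf]] := f_cont t.
have /bounded_choice [K KP] i : exists k, forall h,
    residue k (e h) = residue k (e (tnth t i)) -> U i h.
  by apply: open_ball; apply (Ut i).
exists K => u ut; apply: Uf => i; have [k kK kP] := KP i; apply: kP.
exact: (proj1 (residues_tnth _ _ _) (residues_le kK ut)).
Qed.

(* Compactness of [P ^ s]: were [f] not uniformly locally constant, nested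
   balls on which it is not would shrink to a point of discontinuity. *)
Lemma cont_cochain_uniform :
  exists k, forall t u, residues k t = residues k u -> f t = f u.
Proof.
pose unif j (x : s.-tuple P) := exists k, forall t u,
  residues j t = residues j x -> residues j u = residues j x ->
  residues k t = residues k u -> f t = f u.
have unif_step j x :
    (forall y, residues j y = residues j x -> unif j.+1 y) -> unif j x.
  move=> sub; have [R RP] := residue_cover j.+1 s.
  have /bounded_choice [K KP] (c : {ffun 'I_s -> 'I_(p ^ j.+1)}) : exists k,
      residues j (R c) = residues j x -> forall t u,
      residues j.+1 t = residues j.+1 (R c) ->
      residues j.+1 u = residues j.+1 (R c) ->
      residues k t = residues k u -> f t = f u.
    (* A centre outside the ball of level [j] imposes no condition, so any level will do. *)
    have [/sub [k kP]|n] := pselect (residues j (R c) = residues j x).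
      by exists k.
    by exists 0%N.
  exists (maxn K j.+1) => t u tx ux tu.
  have [c tc] := RP t; have [k kK kP] := KP c.
  have tu1 := residues_le (leq_maxr K j.+1) tu.
  apply: kP => //; first by rewrite -(residues_le (leqnSn j) tc).
  - by rewrite -tu1.
  - by apply: residues_le tu; apply: leq_trans kK (leq_maxl _ _).
apply: contrapT => nunif.
have nunif0 x : ~ unif 0%N x.
  move=> [k kP]; apply: nunif; exists k => t u; apply: kP;
  by apply/residues_tnth => i; apply/rs_eq; eexists; rewrite expn0 mulr1n.
have [nxt nxtP] : {nxt : nat -> s.-tuple P -> s.-tuple P & forall j x,
    ~ unif j x -> residues j (nxt j x) = residues j x /\ ~ unif j.+1 (nxt j x)}.
  have /choice [g gP] : forall jx : nat * s.-tuple P, exists y, ~ unif jx.1 jx.2 ->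
      residues jx.1 y = residues jx.1 jx.2 /\ ~ unif jx.1.+1 y.
    move=> [j x]; apply: contrapT => /forallNP /= none; apply: (none x) => nu.
    exfalso; apply: nu; apply: unif_step => y yx; apply: contrapT => ny.
    by apply: (none y).
  by exists (fun j x => g (j, x)) => j x; apply: (gP (j, x)).
pose x0 : s.-tuple P := [tuple gone P | _ < s].
pose fix ball j := if j is j'.+1 then nxt j' (ball j') else x0.
have ballP j : ~ unif j (ball j).
  by elim: j => [|j IH]; [apply: nunif0|apply: (proj2 (nxtP _ _ IH))].
have ballS j : residues j (ball j.+1) = residues j (ball j).
  by have [] := nxtP _ _ (ballP j).
have lim (i : 'I_s) : exists x : padic p, forall k,
    residue k x = residue k (e (tnth (ball k) i)).
  apply: (zp_limit p_prime (u := fun k => e (tnth (ball k) i))) => k.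
  exact: (proj1 (residues_tnth _ _ _) (ballS k)).
have [x xP] := choice lim.
pose X : s.-tuple P := [tuple io (x i) | i < s].
have XP k : residues k X = residues k (ball k).
  by apply/residues_tnth => i; rewrite tnth_mktuple ioK xP.
(* Continuity at the limit point makes [f] constant on one of the nested balls, a contradiction. *)
have [k kP] := cont_cochain_ball X.
apply: (ballP k); exists 0%N => t u; rewrite -XP => /kP -> /kP -> _.
by [].
Qed.

End Continuity.

Hypothesis e1 : e (gone P) = 0.

(** * Vanishing of continuous cohomology in degrees above two *)

Section Coefficients.
Variables (M : zmodType) (act : P -> M -> M).
Hypothesis act_discrete : discrete_module act.
Let al a := act (io a).

Let al_add a x y : al a (x + y) = al a x + al a y.
Proof. by case: act_discrete => h _ _ _; apply: h. Qed.

Let al_0 x : al 0 x = x.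
Proof. by case: act_discrete => _ h _ _; rewrite /al -e1 eK. Qed.

Let al_act a b x : al (a + b) x = al a (al b x).
Proof.
by case: act_discrete => _ _ h _; rewrite /al -h -{1}(ioK a) -{1}(ioK b) -eM eK.
Qed.

Lemma stabilizer_level v : exists k, forall a, pow_sub p k a -> al a v = v.
Proof.
case: act_discrete => _ _ _ /(_ v) /open_ball h.
have [|k kP] := h (gone P); first by case: act_discrete.
by exists k => a ka; apply: kP; rewrite ioK e1; apply/rs_eq; rewrite subr0.
Qed.

(** By uniformity [f] takes finitely many values, so their stabilizers contain a common open
    subgroup. *)
Lemma homog_loc_const s (f : s.-tuple P -> M) :
  cont_cochain f -> loc_const (@residue p) (homog io act f).
Proof.
move=> /cont_cochain_uniform [k kP]; have [R RP] := residue_cover k s.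
have /bounded_choice [K KP] c := stabilizer_level (f (R c)).
pose L := maxn k K.
have fixf a t : pow_sub p L a -> al a (f t) = f t.
  move=> La; have [c tc] := RP t; have [j jK jP] := KP c.
  rewrite (kP _ _ tc); apply: jP; apply: pow_sub_le La.
  exact: leq_trans jK (leq_maxr _ _).
exists L => l l' ll'.
have sll : size l = size l' by rewrite -(size_map (residue L)) ll' size_map.
have [sl|sl] := boolP (size l == s.+1); last first.
  by rewrite !(supp_homog io act f) // -sll.
have [a [t lE]] := psums_surj ioK (eqP sl).
have [a' [t' lE']] := psums_surj ioK (etrans (esym sll) (eqP sl)).
move: ll'; rewrite lE lE' !homogE // => /(residues_psums _ _ _ _ _ p_prime)[aa' tt'].
rewrite (kP t t'); last first.
  by apply: (residues_le (leq_maxl k K)); rewrite /residues -!map_comp in tt'.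
rewrite -/(al a _) -/(al a' _) -[in LHS](subrK a' a) addrC al_act fixf //.
by apply/rs_eq.
Qed.

Lemma inhom_cont s h : loc_const (@residue p) h ->
  cont_cochain (inhom e h (s := s) : s.-tuple P -> M).
Proof.
move=> [k kP] t; exists (fun i g => residue k (e g) = residue k (e (tnth t i))).
split=> [i|u /residues_tnth ut]; first by split=> //; apply: ball_open.
apply: kP; apply/(residues_psums _ _ _ _ _ p_prime); split=> //.
by rewrite -!map_comp.
Qed.

Lemma primitive_cont_coboundary s (f : s.+1.-tuple P -> M) :
  (exists h, [/\ loc_const (@residue p) h, supp s.+1 h,
    forall a, twist al a h = h & dlt h = homog io act f]) ->
  is_cont_coboundary act f.
Proof.
move=> [h [lh _ hA dh]]; exists (inhom e h (s := s)); split.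
  exact: inhom_cont.
exact: (cobound_of_primitive eK eM al_0 hA dh).
Qed.

Lemma Hc_vanishes s : Hc_zero act s.+3.
Proof.
move=> f f_cont f_cocycle; apply: primitive_cont_coboundary.
apply: (loc_const_primitive (prime_gt1 p_prime) rs_lt rs_eq rs_one al_add al_0 al_act).
- exact: homog_loc_const.
- exact: supp_homog.
- exact: (dlt_homog eK ioK eM al_add al_0 al_act).
- exact: tw_homog.
Qed.

End Coefficients.

(** In degree 0 all cochains are continuous, which also settles injectivity in degree 1. Every
    abstract 1-cocycle is continuous. In degrees at least 2 continuous and abstract cocycles both
    bound. *)
Lemma padic_good : good P.
Proof.
move=> M act act_discrete.
pose al a := act (io a).
have al_add a x y : al a (x + y) = al a x + al a y.
  by case: act_discrete => h _ _ _; apply: h.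
have al_0 x : al 0 x = x.
  by case: act_discrete => _ h _ _; rewrite /al -e1 eK.
have al_act a b x : al (a + b) x = al a (al b x).
  by case: act_discrete => _ _ h _; rewrite /al -h -{1}(ioK a) -{1}(ioK b) -eM eK.
have act0 g : act g 0 = 0 by rewrite -[g]eK; apply: (al_zero al_add).
have card_gt0 : (0 < #|M|)%N by apply/card_gt0P; exists 0.
have cobound0 s t : cobound act (fun _ : s.-tuple P => 0) t = 0.
  have sgn0 k : sgn k (0 : M) = 0 by rewrite /sgn oppr0 if_same.
  by rewrite /cobound act0 sgn0 big1 ?addr0 // => k _; rewrite sgn0.
have al_triv : exists k, forall a v, pow_sub p k a -> al a v = v.
  have /bounded_choice [K KP] := stabilizer_level act_discrete.
  exists K => a v aK; have [k kK kP] := KP v; apply: kP.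
  exact: pow_sub_le aK.
case=> [|[|s]]; split.
- by [].
- move=> f fc; exists f; split=> // [t|t]; last exact: subrr.
  by exists (fun=> xpredT); split=> [[]|u _] //; rewrite [u]tuple0 [t]tuple0.
- move=> f _ _ [h [_ fh]]; exists h; split=> // t.
  by exists (fun=> xpredT); split=> [[]|u _] //; rewrite [u]tuple0 [t]tuple0.
- move=> f fc.
  have dF := dlt_homog eK ioK eM al_add al_0 al_act fc.
  have FA b := tw_homog eK ioK al_add al_act f b.
  pose F := homog io act f; pose phi x := F [:: 0; x].
  have [k kP] := al_triv; pose K := (k + logn p #|M|)%N.
  have phiD x u : phi (x + u) = phi x + al x (phi u).
    have -> : al x (phi u) = F [:: x; x + u].
      by rewrite -[F in RHS](FA x) /twist /= subrr [x + u]addrC addrK.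
    have : dlt F [:: 0; x; x + u] = 0 by rewrite dF.
    rewrite (_ : dlt F _ = F [:: x; x + u] - (F [:: 0; x + u] - (F [:: 0; x] - 0))) //.
    by rewrite subr0 => /subr0_eq ->; rewrite /phi; zmod.
  (* On the open subgroup acting trivially on [M] the crossed homomorphism [phi] is additive, so it
     vanishes on multiples of [#|M|], which include [pow_sub p K]. *)
  have phi0 u : pow_sub p K u -> phi u = 0.
    move=> /(pow_sub_mulrn p_prime card_gt0 (@zp_divides_coprime p)) [w ->].
    rewrite mulrnA -[RHS](finZmod_mulrn_card (phi (w *+ p ^ k))).
    elim: #|M| => [|n IH].
      by apply: (addrI (phi 0)); rewrite -{2}(al_0 (phi 0)) -phiD !addr0.
    rewrite mulrSr phiD IH mulrSr kP //.
    by exists (w *+ n); rewrite -!mulrnA mulnC.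
  have phi_loc x y : residue K x = residue K y -> phi x = phi y.
    move=> /rs_eq xy; rewrite -(subrK y x) addrC phiD.
    by rewrite [phi (x - y)]phi0 // /al act0 addr0.
  have fphi t : f t = phi (e (thead t)).
    rewrite -[f in LHS](inhom_homog eK al_0) /inhom /psums.
    case: t => -[|g []] //= sz; rewrite add0r /phi.
    by rewrite [thead _](tnth_nth g).
  exists f; split=> // [t|].
    exists (fun i g => residue K (e g) = residue K (e (tnth t i))).
    by split=> // u ut; rewrite !fphi; apply: phi_loc; apply: ut.
  by exists (fun=> 0); split=> // t; rewrite cobound0 subrr.
- move=> f f_cont f_cocycle _; apply: (primitive_cont_coboundary act_discrete).
  apply: (loc_const_primitive_finite (prime_gt1 p_prime) rs_lt rs_eq rs_one
    al_add al_0 al_act p_prime card_gt0 (@finZmod_mulrn_card M)).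
  + exact: homog_loc_const.
  + exact: supp_homog.
  + exact: (dlt_homog eK ioK eM al_add al_0 al_act).
  + exact: tw_homog.
move=> f fc; exists (fun=> 0); split.
- move=> t; exists (fun i g => residue 0 (e g) = residue 0 (e (tnth t i))).
  by split=> // i; split=> //; apply: ball_open.
- by move=> t; apply: cobound0.
have [h [sh hA dh]] := abstract_primitive p_prime rs_lt rs_eq rs_one
  (@zp_torsion_free p p_prime) (@zp_divides_coprime p)
  al_add al_0 al_act al_triv (supp_homog io act f)
  (dlt_homog eK ioK eM al_add al_0 al_act fc) (tw_homog eK ioK al_add al_act f).
exists (inhom e h (s := s.+1)); split=> // t; rewrite subr0.
exact: (cobound_of_primitive eK eM al_0 hA dh).
Qed.

End PadicGroup.

(** * The filtration *)

Lemma subgrp_eq (G : topgrp) (N : G -> Prop) (HN : is_subgroup N)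
  (g h : subgrp HN) : proj1_sig g = proj1_sig h -> g = h.
Proof.
case: g h => [g gN] [h hN] /= gh; case: _ / gh in hN *.
by congr exist; apply: Prop_irrelevance.
Qed.

Section Filtration.
Variables (p : nat) (H : finGroupType).
Hypothesis p_prime : prime p.

Definition ball (n : nat) : ZpxH p H -> Prop :=
  fun g => proj1_sig g.1 n = 0 /\ g.2 = 1%g.

Lemma ball_subgroup n : is_subgroup (ball n).
Proof.
split=> [|x y [x1 x2] [y1 y2]|x [x1 x2]]; split => //=.
- by rewrite x1 y1 mod0z.
- by rewrite x2 y2 mulg1.
- by rewrite x1 oppr0 mod0z.
by rewrite x2 invg1.
Qed.

Lemma ball_normal n : is_normal (ball n).
Proof.
move=> g x [x1 x2]; split; last by rewrite /= x2 mulg1 mulgV.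
by rewrite -[X in proj1_sig X]/((g.1 : padic p) + x.1 - g.1) addrAC subrr add0r.
Qed.

Lemma ball_open n : @gopen (ZpxH p H) (ball n).
Proof. by move=> a [a1 a2]; exists n => y yn; split; rewrite //= yn. Qed.

Lemma pow_ball n (a : padic p) : ball n (a *+ p ^ n, 1%g).
Proof. by split=> //=; rewrite zp_mulrnE -/(ppow p n) modzMl. Qed.

Lemma ball_le m n : (m <= n)%N <-> (forall x, ball n x -> ball m x).
Proof.
split=> [mn x [x1 x2]|sub].
  by split=> //; rewrite -(zp_mod_le x.1 mn) x1 mod0z.
(* The inclusion is tested on the element [p ^ n]. *)
have [/=] := sub _ (pow_ball n (zp_one p)).
rewrite -residueE // residue_one // => -[/eqP].
by rewrite -/(dvdn _ _) dvdn_Pexp2l // prime_gt1.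
Qed.

Lemma mulrn_pow_inj n : injective (fun a : padic p => a *+ p ^ n).
Proof.
move=> a b ab; apply: subr0_eq; apply: (@zp_torsion_free p p_prime _ (p ^ n)%N).
  by rewrite -[LHS]/((a - b) *+ p ^ n) mulrnBl ab subrr.
by rewrite eqz_nat -lt0n expn_gt0 prime_gt0.
Qed.

Let B n := subgrp (ball_subgroup n).

(** [e] is division by [p ^ n] in the first component, unique because the p-adic integers have no
    torsion. *)
Lemma ball_padic n : exists (e : B n -> padic p) (io : padic p -> B n),
  [/\ cancel e io, cancel io e, forall g h, e (gmul g h) = e g + e h,
      e (gone (B n)) = 0 & forall g, (proj1_sig g).1 = e g *+ p ^ n].
Proof.
have [e eP] : {e : B n -> padic p & forall g, (proj1_sig g).1 = e g *+ p ^ n}.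
  apply: (choice (P := fun (g : B n) (z : padic p) => (proj1_sig g).1 = z *+ p ^ n)).
  by move=> -[g [g1 g2]]; exact: (zp_divides p_prime g1).
have inj := @mulrn_pow_inj n.
exists e, (fun a => exist _ _ (pow_ball n a)); split=> //.
- move=> g; have gE : (e g *+ p ^ n, 1%g) = proj1_sig g.
    by rewrite -eP -(proj2 (proj2_sig g)) -surjective_pairing.
  exact: subgrp_eq.
- by move=> a; apply: inj; rewrite -eP.
- by move=> g h; apply: inj; rewrite mulrnDl -!eP.
by apply: inj; rewrite -eP mul0rn.
Qed.

Section Topology.
Variables (n : nat) (e : B n -> padic p).
Hypothesis eP : forall g, (proj1_sig g).1 = e g *+ p ^ n.

Lemma open_ball (V : B n -> Prop) g : gopen V -> V g ->
  exists k, forall h, residue k (e h) = residue k (e g) -> V h.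
Proof.
move=> [U [Uopen VU]] /VU /Uopen [k kP]; exists k => h hg; apply/VU.
have := kP (proj1_sig h).1.
have -> : (proj1_sig g).2 = (proj1_sig h).2.
  by rewrite (proj2 (proj2_sig g)) (proj2 (proj2_sig h)).
rewrite -surjective_pairing; apply.
by rewrite !eP !zp_mulrnE; move/(residueP p_prime): hg => ->.
Qed.

Lemma residue_open k g : @gopen (B n) (fun h => residue k (e h) = residue k (e g)).
Proof.
(* Since [e] divides by [p ^ n], level [k] for [e] is level [n + k] in the ambient group. *)
exists (fun x => residue (n + k) x.1 = residue (n + k) (proj1_sig g).1); split.
  by move=> a /= ag; exists (n + k)%N => y /(residueP p_prime) ->.
move=> h; rewrite !residue_eq // !eP; split=> -[z zP].
  by exists z; rewrite -mulrnBl zP -!mulrnA expnD mulnC.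
by exists z; apply: (@mulrn_pow_inj n); rewrite /= mulrnBl zP -mulrnA expnD mulnC.
Qed.

End Topology.
End Filtration.

Theorem theorem3p6 (p : nat) (H : finGroupType) :
  prime p -> has_good_filtration (ZpxH p H).
Proof.
move=> p_prime.
exists nat, (fun m n => (m <= n)%N), (@ball p H), (@ball_subgroup p H).
split.
- split=> //.
  + by move=> a b c ab; apply: leq_trans ab.
  + by move=> a b ab ba; apply/eqP; rewrite eqn_leq ab.
  + by move=> a b; exists (maxn a b); rewrite leq_maxl leq_maxr.
- by move=> n; split; [apply: ball_normal|apply: ball_open].
- by move=> a b; apply: ball_le.
- move=> [x h] xh; have [_ /= ->] := xh 0%N; congr (_, _).
  by apply: zp_eqP => n; rewrite (proj1 (xh n)).
split=> [n|].
  have [e [io [eK ioK eM e1 eP]]] := ball_padic H p_prime n.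
  apply: (padic_good p_prime eK ioK eM) => //.
    exact: open_ball.
  exact: residue_open.
exists 2 => n M act act_discrete [|[|[|s]]] // _.
have [e [io [eK ioK eM e1 eP]]] := ball_padic H p_prime n.
apply: (Hc_vanishes p_prime eK ioK eM) => //.
  exact: open_ball.
exact: residue_open.
Qed.
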